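(* Let $(\Omega,\varphi)$ be a tame semicascade such that for each $\omega\in\Omega$ the closure $\overline{o}(\omega)$ of the trajectory of $\omega$ contains a unique minimal set. Then all ergodic operator sequences $T_n\in G_0$ converge in the $\mathrm{W}^*\mathrm{O}$-topology, and the support of each $\varphi$-ergodic measure is a minimal set.
   Context: $\Omega$ is a metrizable compact space and $\varphi:\Omega\to\Omega$ is a continuous (not necessarily invertible) map; $(\Omega,\varphi)$ is the corresponding semicascade. $X=C(\Omega)$ is the Banach space of continuous scalar functions, $X^*$ its dual (Borel measures on $\Omega$), with pairing $(x,\mu)=\int_\Omega x\,d\mu$. $U\in\mathrm{End}\,X$ is $(Ux)(\omega)=x(\varphi\omega)$, $V=U^*\in\mathrm{End}\,X^*$, $I$ is the identity; $\mathrm{End}$ denotes bounded linear operators. The $\mathrm{W}^*\mathrm{O}$-topology on $\mathrm{End}\,X^*$: $T_\alpha\to T$ iff $(x,T_\alpha y)\to(x,Ty)$ for all $x\in X$, $y\in X^*$. $G_0=\mathrm{co}\{V^n:n\ge 0\}$ (convex hull). A sequence of operators $T_n\in G_0$ is ergodic if $T_n(I-V)\to 0$ in the $\mathrm{W}^*\mathrm{O}$-topology. The semicascade is tame if, for each $x\in C(\Omega)$ and each increasing sequence $\{n(k)\}$ of positive integers, $\inf_a\|\sum_{k\ge 1}a_kx_{n(k)}\|_{C(\Omega)}=0$, where $x_n(\omega)=x(\varphi^n\omega)$ and the infimum is over finite (finitely supported) real sequences $a=\{a_k\}$ with $\sum_k|a_k|=1$. $\overline{o}(\omega)$ is the closure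 in $\Omega$ of $\{\varphi^n\omega:n\ge 0\}$. A minimal set is a nonempty closed set $m\subset\Omega$ with $\varphi m\subset m$ that has no proper subset with the same properties. A $\varphi$-ergodic measure is a $\varphi$-invariant Borel probability measure $\lambda$ on $\Omega$ such that $\lambda(e)\in\{0,1\}$ for every Borel set $e$ with $\varphi^{-1}e=e$. *)

(* Defs.v *)
From HB Require Import structures.
From mathcomp Require Import all_boot all_order all_algebra.
From mathcomp Require Import complex.
From mathcomp Require Import all_classical all_reals all_analysis.

Set Implicit Arguments.
Unset Strict Implicit.
Unset Printing Implicit Defensive.

Import Order.TTheory GRing.Theory Num.Theory.
Import numFieldNormedType.Exports.

Local Open Scope classical_set_scope.
Local Open Scope ring_scope.

(* Measurable types of the library are pointed, hence nonempty. *)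
#[short(type="pmetricType")]
HB.structure Definition PointedMetric (R : numDomainType) :=
  { T of Metric R T & Pointed T }.

Variant real_or_complex (R : realType) : numFieldType -> Prop :=
  | real_scalars : real_or_complex R R
  | complex_scalars : real_or_complex R (complex R).

(* Norms take their values in K, so suprema are taken in the order of K, in
   which only numbers with the same imaginary part are comparable. *)
Lemma real_or_complex_sup (R : realType) (K : numFieldType)
    (hK : real_or_complex R K) (A : set K) :
  A !=set0 -> (forall x, A x -> 0 <= x) -> has_ubound A ->
  supremums A (supremum 0 A).
Proof.
move=> A0 Age0 uA.
suff [s hs] : exists s, supremums A s.
  rewrite /supremum ifF; last by apply/negbTE/set0P.
  by case: xgetP => [x _ hx|/(_ s)].
case: K / hK A A0 Age0 uA => A A0 Age0 [u Au].
  exists (sup A); split; first by apply: sup_upper_bound; split=> //; exists u.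
  by move=> b Ab; apply: ge_sup.
pose B : set R := [set r | A (Complex r 0)].
have AB (z : complex R) : A z -> z = Complex (complex.Re z) 0.
  by move=> /Age0; case: z => a b; rewrite lecE /= => /andP[/eqP -> _].
have [z0 Az0] := A0.
have B0 : B !=set0 by exists (complex.Re z0); rewrite /B /= -AB.
have uB : has_ubound B.
  by exists (complex.Re u) => r /Au; rewrite lecE => /andP[].
exists (Complex (sup B) 0); split.
  move=> z Az; rewrite (AB _ Az) lecE /= eqxx /=.
  by apply: (@sup_upper_bound _ B); [split|rewrite /B /= -AB].
move=> b Ab; have := Ab _ Az0; rewrite (AB _ Az0) lecE /= => /andP[/eqP b0 _].
rewrite lecE /= b0 eqxx /=; apply: ge_sup => // r Br.
by have := Ab _ Br; rewrite lecE /= => /andP[].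
Qed.

Section sup_norm.
Context (R : realType) (K : numFieldType) (hK : real_or_complex R K).
Context (V : normedZmodType K) (I : Type) (f : I -> V) (D : set I).
Hypothesis D0 : D !=set0.

Lemma supremum_norm_ub (M : K) : (forall i, D i -> `|f i| <= M) ->
  forall i, D i -> `|f i| <= supremum 0 [set `|f i| | i in D].
Proof.
move=> fM i Di.
have [+ _] : supremums [set `|f i| | i in D] (supremum 0 [set `|f i| | i in D]).
  apply: (real_or_complex_sup hK); first by exists `|f i|, i.
    by move=> _ [j _ <-].
  by exists M => _ [j Dj <-]; exact: fM.
by apply; exists i.
Qed.

Lemma supremum_norm_le (M : K) : (forall i, D i -> `|f i| <= M) ->
  supremum 0 [set `|f i| | i in D] <= M.
Proof.
move=> fM; have [i Di] := D0.
have [_ ] : supremums [set `|f i| | i in D] (supremum 0 [set `|f i| | i in D]).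
  apply: (real_or_complex_sup hK); first by exists `|f i|, i.
    by move=> _ [j _ <-].
  by exists M => _ [j Dj <-]; exact: fM.
by apply => _ [j Dj <-]; exact: fM.
Qed.

End sup_norm.

Section continuous_functions.
Context (R : realType) (K : numFieldType) (hK : real_or_complex R K).
Context (Omega : topologicalType) (cO : compact [set: Omega]).

Definition continuous_pred : {pred Omega -> K} :=
  mem [set x : Omega -> K | continuous x].

Lemma continuous_submod_closed : submod_closed continuous_pred.
Proof.
split=> [|a x y]; first by apply/mem_set => w; exact: cvg_cst.
move=> /set_mem cx /set_mem cy; apply/mem_set => w.
by apply: cvgD; [apply: cvgZr; exact: cx|exact: cy].
Qed.

HB.instance Definition _ := GRing.isSubmodClosed.Build K (Omega -> K)
  continuous_pred continuous_submod_closed.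

(* [hK] and [cO] are phantom parameters that make the norm well defined. *)
Record cfun (phK : real_or_complex R K) (phO : compact [set: Omega]) :=
  CFun { cfun_val :> Omega -> K ; cfun_valP : cfun_val \in continuous_pred }.

Local Notation X := (cfun hK cO).

HB.instance Definition _ := [isSub of X for @cfun_val hK cO].
HB.instance Definition _ := [Choice of X by <:].
HB.instance Definition _ := [SubChoice_isSubLmodule of X by <:].

Lemma cfun_continuous (x : X) : continuous x.
Proof. by have /set_mem := cfun_valP x. Qed.

Definition mkcfun (f : Omega -> K) (cf : continuous f) : X :=
  @CFun hK cO f (mem_set cf).

Definition cfun_norm (x : X) : K := supremum 0 [set `|x w| | w in [set: Omega]].

Lemma cfun_bounded (x : X) : exists M, forall w, `|x w| <= M.
Proof.
have /compact_near_coveringP cov := cO.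
have [w _|M [Mr xM]] := cov K +oo (fun M w => `|x w| <= M) _.
  exists ([set w' | `|x w - x w'| < 1], [set M | `|x w| + 1 < M]).
    split=> /=; last by exists (`|x w| + 1); split=> //; by rewrite realD.
    have /cvgr_dist_lt := @cfun_continuous x w; apply; exact: ltr01.
  move=> [w' M] [/= xw /ltW wM]; rewrite (le_trans _ wM)//.
  by rewrite -lerBlDl (le_trans (lerB_dist _ _))// distrC ltW.
exists (M + 1) => w; apply: (xM (M + 1)) => //.
by rewrite ltrDl ltr01.
Qed.

Lemma cfun_norm_ub (x : X) w : `|x w| <= cfun_norm x.
Proof.
have [M xM] := cfun_bounded x.
exact: (supremum_norm_ub hK (D := [set: Omega]) (M := M)).
Qed.

Lemma cfun_norm_le (x : X) (M : K) :
  0 <= M -> (forall w, `|x w| <= M) -> cfun_norm x <= M.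
Proof.
move=> M0 xM; have [e|ne] := eqVneq [set: Omega] set0.
  by rewrite /cfun_norm e image_set0 supremum0.
by apply: (supremum_norm_le hK) => //; exact/set0P.
Qed.

Lemma cfun_norm_ge0 (x : X) : 0 <= cfun_norm x.
Proof.
have [e|/set0P[w _]] := eqVneq [set: Omega] set0.
  by rewrite /cfun_norm e image_set0 supremum0.
exact: le_trans (cfun_norm_ub x w).
Qed.

Lemma cfun_normD (x y : X) : cfun_norm (x + y) <= cfun_norm x + cfun_norm y.
Proof.
apply: cfun_norm_le => [|w]; first by rewrite addr_ge0 ?cfun_norm_ge0.
by apply: (le_trans (ler_normD _ _)); rewrite lerD ?cfun_norm_ub.
Qed.

Lemma cfun_normZ (a : K) (x : X) : cfun_norm (a *: x) = `|a| * cfun_norm x.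
Proof.
have le b z : cfun_norm (b *: z) <= `|b| * cfun_norm z.
  apply: cfun_norm_le => [|w]; first by rewrite mulr_ge0 ?cfun_norm_ge0.
  by rewrite [X in X <= _]normrM ler_wpM2l ?cfun_norm_ub.
apply/eqP; rewrite eq_le le /=.
have [->|a0] := eqVneq a 0; first by rewrite normr0 mul0r cfun_norm_ge0.
by rewrite mulrC -ler_pdivlMr ?normr_gt0// mulrC -normfV
  -{1}[x](scalerK a0) le.
Qed.

Lemma cfun_norm0_eq0 (x : X) : cfun_norm x = 0 -> x = 0.
Proof.
move=> x0; apply/val_inj/funext => w; apply/eqP.
by rewrite -normr_le0 -x0 cfun_norm_ub.
Qed.

HB.instance Definition _ := @Lmodule_isNormed.Build K X
  cfun_norm cfun_normD cfun_normZ cfun_norm0_eq0.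

End continuous_functions.

Section bounded_operators.
Context (R : realType) (K : numFieldType) (hK : real_or_complex R K).
Context (E F : normedModType K).

Definition bounded_linear_pred : {pred E -> F} :=
  mem [set f : E -> F | linear f /\ exists M, forall u, `|f u| <= M * `|u| ].

Lemma bounded_linear_submod_closed : submod_closed bounded_linear_pred.
Proof.
split=> [|a f g].
  apply/mem_set; split=> [b u v|]; first by rewrite /= scaler0 addr0.
  by exists 0 => u; rewrite normr0 mul0r.
move=> /set_mem[lf [M fM]] /set_mem[lg [N gN]]; apply/mem_set; split.
  move=> b u v /=; rewrite !fctE lf lg !scalerDr !scalerA mulrC -!addrA.
  by congr (_ + _); rewrite addrCA.
exists (`|a| * M + N) => u; rewrite (le_trans (ler_normD _ _))// mulrDl.
by rewrite lerD ?gN// normrZ -mulrA ler_wpM2l.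
Qed.

HB.instance Definition _ := GRing.isSubmodClosed.Build K (E -> F)
  bounded_linear_pred bounded_linear_submod_closed.

Record bop (phK : real_or_complex R K) :=
  BOp { bop_val :> E -> F ; bop_valP : bop_val \in bounded_linear_pred }.

Local Notation B := (bop hK).

HB.instance Definition _ := [isSub of B for @bop_val hK].
HB.instance Definition _ := [Choice of B by <:].
HB.instance Definition _ := [SubChoice_isSubLmodule of B by <:].

Lemma bop_linear (f : B) : linear f.
Proof. by have /set_mem[] := bop_valP f. Qed.

HB.instance Definition _ (f : B) :=
  GRing.isLinear.Build K E F _ f (bop_linear f).

Lemma bop_bounded (f : B) : exists2 M, 0 <= M & forall u, `|f u| <= M * `|u|.
Proof.
have /set_mem[_ [M fM]] := bop_valP f; exists `|M| => // u.
by rewrite -(normr_id u) -normrM ger0_norm ?fM// (le_trans _ (fM u)).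
Qed.

Definition mkbop (f : E -> F) (lf : linear f)
    (bf : exists M, forall u, `|f u| <= M * `|u|) : B :=
  @BOp hK f (mem_set (conj lf bf)).

Definition bop_norm (f : B) : K :=
  supremum 0 [set `|f u| | u in [set u : E | `|u| <= 1]].

Let ball1_neq0 : [set u : E | `|u| <= 1] !=set0.
Proof. by exists 0; rewrite /= normr0 ler01. Qed.

Lemma bop_norm_ge0 (f : B) : 0 <= bop_norm f.
Proof.
have [M M0 fM] := bop_bounded f.
apply: (le_trans (normr_ge0 (f 0))).
apply: (@supremum_norm_ub _ _ hK _ _ f [set u : E | `|u| <= 1] M) => /=.
  by move=> u /= u1; rewrite (le_trans (fM u))// ler_piMr.
by rewrite normr0 ler01.
Qed.

Lemma bop_norm_ub (f : B) u : `|f u| <= bop_norm f * `|u|.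
Proof.
have [->|u0] := eqVneq u 0; first by rewrite linear0 !normr0 mulr0.
have [M M0 fM] := bop_bounded f.
have n0 : 0 < `|u| by rewrite normr_gt0.
rewrite -ler_pdivrMr//.
have -> : `|f u| / `|u| = `|f (`|u|^-1 *: u)|.
  by rewrite linearZ normrZ normfV normr_id mulrC.
apply: (@supremum_norm_ub _ _ hK _ _ f [set u : E | `|u| <= 1] M) => /=.
  by move=> v /= v1; rewrite (le_trans (fM v))// ler_piMr.
by rewrite normrZ normfV normr_id mulVf ?gt_eqF.
Qed.

Lemma bop_norm_le (f : B) (M : K) :
  0 <= M -> (forall u, `|f u| <= M * `|u|) -> bop_norm f <= M.
Proof.
move=> M0 fM; apply: (supremum_norm_le hK) => // u /= u1.
by rewrite (le_trans (fM u))// ler_piMr.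
Qed.

Lemma bop_normD (f g : B) : bop_norm (f + g) <= bop_norm f + bop_norm g.
Proof.
apply: bop_norm_le => [|u]; first by rewrite addr_ge0 ?bop_norm_ge0.
by rewrite mulrDl (le_trans (ler_normD _ _))// lerD ?bop_norm_ub.
Qed.

Lemma bop_normZ (a : K) (f : B) : bop_norm (a *: f) = `|a| * bop_norm f.
Proof.
have le b g : bop_norm (b *: g) <= `|b| * bop_norm g.
  apply: bop_norm_le => [|u]; first by rewrite mulr_ge0 ?bop_norm_ge0.
  by rewrite [X in X <= _]normrZ -mulrA ler_wpM2l ?bop_norm_ub.
apply/eqP; rewrite eq_le le /=.
have [->|a0] := eqVneq a 0; first by rewrite normr0 mul0r bop_norm_ge0.
by rewrite mulrC -ler_pdivlMr ?normr_gt0// mulrC -normfV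
  -{1}[f](scalerK a0) le.
Qed.

Lemma bop_norm0_eq0 (f : B) : bop_norm f = 0 -> f = 0.
Proof.
move=> f0; apply/val_inj/funext => u; apply/eqP.
by rewrite -normr_le0 (le_trans (bop_norm_ub f u))// f0 mul0r.
Qed.

HB.instance Definition _ := @Lmodule_isNormed.Build K B
  bop_norm bop_normD bop_normZ bop_norm0_eq0.

End bounded_operators.

Arguments bop {R K} E F phK.

Section operator_algebra.
Context (R : realType) (K : numFieldType) (hK : real_or_complex R K).

Lemma bid_linear (E : normedModType K) : linear (idfun : E -> E).
Proof. by []. Qed.

Lemma bid_bounded (E : normedModType K) :
  exists M, forall u : E, `|idfun u| <= M * `|u|.
Proof. by exists 1 => u; rewrite mul1r. Qed.

Definition bid (E : normedModType K) : bop E E hK :=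
  mkbop hK (@bid_linear E) (@bid_bounded E).

Lemma bcomp_linear (E F G : normedModType K) (g : bop F G hK) (f : bop E F hK) :
  linear (g \o f).
Proof. by move=> a u v /=; rewrite !linearP. Qed.

Lemma bcomp_bounded (E F G : normedModType K) (g : bop F G hK)
    (f : bop E F hK) : exists M, forall u, `|(g \o f) u| <= M * `|u|.
Proof.
exists (bop_norm g * bop_norm f) => u /=.
by rewrite (le_trans (bop_norm_ub _ _))// -mulrA ler_wpM2l ?bop_norm_ge0
  ?bop_norm_ub.
Qed.

Definition bcomp (E F G : normedModType K) (g : bop F G hK)
    (f : bop E F hK) : bop E G hK :=
  mkbop hK (bcomp_linear g f) (bcomp_bounded g f).

Definition bpow (E : normedModType K) (T : bop E E hK) (n : nat) : bop E E hK :=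
  iter n (bcomp T) (bid E).

(* By the Riesz representation theorem, [dual (cfun hK cO)] is the space of
   K-valued Borel measures on Omega, with [y x] the integral of x against y. *)
Definition dual (E : normedModType K) : normedModType K := bop E K^o hK.

Lemma adjoint_linear (E : normedModType K) (T : bop E E hK) :
  linear (fun y : dual E => bcomp y T : dual E).
Proof. by move=> a y z; exact/val_inj. Qed.

Lemma adjoint_bounded (E : normedModType K) (T : bop E E hK) :
  exists M, forall y : dual E, `|(bcomp y T : dual E)| <= M * `|y|.
Proof.
exists (bop_norm T) => y.
apply: bop_norm_le => [|u]; first by rewrite mulr_ge0 ?bop_norm_ge0.
rewrite (le_trans (bop_norm_ub y (T u)))// [leRHS]mulrAC mulrC.
by rewrite ler_wpM2r ?bop_norm_ub ?bop_norm_ge0.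
Qed.

Definition adjoint (E : normedModType K) (T : bop E E hK) :
    bop (dual E) (dual E) hK := mkbop hK (adjoint_linear T) (adjoint_bounded T).

End operator_algebra.

Section wstar_operator_topology.
Context (R : realType) (K : numFieldType) (hK : real_or_complex R K).
Context (E : normedModType K).
Local Notation EndX := (bop (dual hK E) (dual hK E) hK).

(* [End E^*] with the W*O-topology: the initial topology for the maps
   [T |-> (x, T y)], where [(x, y) = y x]. *)
Definition wstar_eval (T : EndX) :
    {ptws E * dual hK E -> K} := fun p => T p.2 p.1.

Definition wstar_op : Type := initial_topology wstar_eval.

HB.instance Definition _ := Topological.on wstar_op.

Definition wstar_cvg (T_ : nat -> EndX) (T : EndX) : Prop :=
  (T_ : nat -> wstar_op) @ \oo --> (T : wstar_op).

Lemma wstar_cvgP (T_ : nat -> EndX) (T : EndX) :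
  wstar_cvg T_ T <->
  forall (x : E) (y : dual hK E), T_ n y x @[n --> \oo] --> T y x.
Proof.
have cvgE : wstar_cvg T_ T <->
    wstar_eval \o T_ @ \oo --> wstar_eval T.
  split=> h.
    apply: (@continuous_cvg _ wstar_op {ptws E * dual hK E -> K}) h.
    exact: initial_continuous.
  move=> A [_ [[B oB <-] /= BT] BA].
  by apply: filterS BA _; apply: h; exact: open_nbhs_nbhs.
have pE := @pointwise_cvgP (E * dual hK E)%type K (wstar_eval \o T_ @ \oo).
split=> [/cvgE/pE h x y|h]; first exact: (h (x, y)).
by apply/cvgE/pE => -[x y]; exact: h.
Qed.

End wstar_operator_topology.

(* In a complex field K, [0 <= a i] entails that [a i] is real. *)
Definition convex_hull (K : numFieldType) (V : lmodType K) (A : set V) :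
    set V :=
  [set v | exists n (a : 'I_n -> K) (u : 'I_n -> V),
    [/\ forall i, 0 <= a i, \sum_i a i = 1, forall i, A (u i) &
        v = \sum_i a i *: u i]].

Section semicascade.
Context (R : realType) (K : numFieldType) (hK : real_or_complex R K).
Context (Omega : topologicalType) (cO : compact [set: Omega]).
Context (phi : Omega -> Omega) (cphi : continuous phi).
Local Notation X := (cfun hK cO).

Definition cfun_comp (x : X) : X :=
  mkcfun hK cO (fun w => continuous_comp (@cphi w)
    (@cfun_continuous _ _ hK _ cO x (phi w))).

Lemma cfun_comp_linear : linear cfun_comp.
Proof. by move=> a x y; exact/val_inj. Qed.

Lemma cfun_comp_bounded : exists M, forall x, `|cfun_comp x| <= M * `|x|.
Proof.
exists 1 => x; rewrite mul1r.
apply: cfun_norm_le => [|w]; first exact: cfun_norm_ge0.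
exact: (cfun_norm_ub x (phi w)).
Qed.

Definition koopman : bop X X hK := mkbop hK cfun_comp_linear cfun_comp_bounded.

Lemma iter_koopmanE (n : nat) (x : X) w :
  iter n koopman x w = x (iter n phi w).
Proof. by elim: n w => //= n IH w; rewrite IH -iterSr. Qed.

Local Notation V := (adjoint koopman).

Definition G0 : set (bop (dual hK X) (dual hK X) hK) :=
  convex_hull (range (bpow V)).

Definition ergodic_sequence
    (T_ : nat -> bop (dual hK X) (dual hK X) hK) : Prop :=
  (forall n, G0 (T_ n)) /\
  wstar_cvg (fun n => bcomp (T_ n) (bid hK (dual hK X) - V)) 0.

(* [infimums S 0] says that 0 is the infimum of S in the order of K; the
   function written x_n(w) = x(phi^n w) is [iter n koopman x]. *)
Definition tame : Prop :=
  forall (x : X) (n : nat -> nat),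
    (forall k, 0 < n k)%N -> {homo n : i j / (i < j)%N} ->
    infimums [set s : K | exists N (a : 'I_N -> K),
      [/\ forall k, a k \is Num.real, \sum_k `|a k| = 1 &
          s = `|\sum_k a k *: iter (n k) koopman x| ]] 0.

End semicascade.

Section dynamics.
Context (Omega : topologicalType) (phi : Omega -> Omega).

Definition orbit_closure (w : Omega) : set Omega :=
  closure (range (fun n => iter n phi w)).

Definition closed_invariant (m : set Omega) : Prop :=
  [/\ m !=set0, closed m & phi @` m `<=` m].

Definition minimal_set (m : set Omega) : Prop :=
  closed_invariant m /\
  forall m', closed_invariant m' -> m' `<=` m -> m' = m.

End dynamics.

Notation borel Omega := (g_sigma_algebraType (@open Omega)).

Section ergodic_measures.
Context (R : realType) (Omega : pmetricType R) (phi : Omega -> Omega).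

Definition ergodic_measure (la : probability (borel Omega) R) : Prop :=
  (forall e : set (borel Omega), measurable e -> la (phi @^-1` e) = la e) /\
  (forall e : set (borel Omega), measurable e -> phi @^-1` e = e ->
    la e = 0%E \/ la e = 1%E).

Definition measure_support (la : probability (borel Omega) R) : set Omega :=
  [set w | forall U : set Omega, open U -> U w -> (0 < la U)%E].

End ergodic_measures.

(* Main.v *)
(* A sequence of functions is independent at two levels a < b if every finite pattern of
   being below a or above b is realized; such a sequence spans l^1, so in a tame system no
   sequence of translates x o phi^n(k) is independent. For a finite measure mu and an
   ultrafilter U on the integers, this forces the translates x o phi^n to be U-Cauchy in
   mu-measure, and their pointwise U-limits to be limits in measure: a dominated
   convergence theorem along ultrafilters.
   Let S be an orbit closure, or the support of an ergodic measure, and m its unique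
   minimal set. Some free ultrafilter brings all points of S to m simultaneously, and the
   previous fact shows that invariant measures on S live on m. This settles the supports.
   If two invariant means on S disagreed on x, the Cesaro means of x would oscillate on
   every open set meeting m, hence contain an independent sequence; against a coin-tossing
   measure on the patterns this contradicts the total boundedness in measure of the
   translates of x, which their convex hull inherits. So S carries one invariant mean and
   ergodic sequences converge pointwise on C(Omega). A functional on C(Omega) is dominated
   by a finite Borel measure (its total variation), which turns bounded pointwise
   convergence into weak convergence. *)
From HB Require Import structures.
Require Import Defs.
From mathcomp Require Import all_boot all_order all_algebra.
From mathcomp Require Import complex.
From mathcomp Require Import all_classical all_reals all_analysis.
From mathcomp Require Import measurable_realfun ring lra.

Set Implicit Arguments.
Unset Strict Implicit.
Unset Printing Implicit Defensive.

Import Order.TTheory GRing.Theory Num.Theory.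
Import numFieldNormedType.Exports.

Local Open Scope classical_set_scope.
Local Open Scope ring_scope.

(** * Independent sequences *)

(** Pointwise limits along an ultrafilter may fail to be measurable, and dominated convergence along
    ultrafilters fails in general. Limits are therefore never integrated: convergence in measure is
    stated through the measurable sets where two members of a sequence, or a member and a level, lie
    apart. In the same way the pointwise limits of ergodic sequences need not be continuous in the
    point, so a functional cannot be applied to them; it is shown instead that its values form a
    Cauchy sequence. A functional l meets measures only through the inequality |l f| <= M e + c
    mu{|f| > e}, valid when |f| <= c. Tameness controls translates, not their Cesaro means. The link
    is total boundedness in mean, which convex hulls inherit. Since independence realizes finite
    patterns only, coin tossing exists on finitely many coordinates at a time, and an ultralimit of
    means joins these pieces. *)

Section independence.
Context {R : realType} {T : Type}.

Definition side (f : T -> R) (r' r : R) (b : bool) : set T :=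
  if b then [set t | r < f t] else [set t | f t < r'].

Definition independent (f : nat -> T -> R) (r' r : R) : Prop :=
  forall (b : nat -> bool) N,
    exists t, forall k, (k < N)%N -> side (f k) r' r (b k) t.

(** The conditions on [n] are those of the sequences in [tame]; positive indices also exclude the
    empty Cesaro average. *)
Definition no_independent (f : nat -> T -> R) (r' r : R) : Prop :=
  ~ exists n : nat -> nat, [/\ forall k, (0 < n k)%N,
      {homo n : i j / (i < j)%N} & independent (f \o n) r' r].

(** Indices are chosen one by one so that every cell cut out by a pattern stays [Big]; at each stage
    the cells are finite in number, so one index from the filter serves them all. [Big] will mean
    non-null inside a remainder, and later open and meeting a minimal set. *)
Lemma independent_subsequence (f : nat -> T -> R) (r' r : R)
    (F : set_system nat) (Big : set (set T)) :
  ProperFilter F -> (forall N, \forall n \near F, (N <= n)%N) ->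
  Big setT -> (forall V, Big V -> V !=set0) ->
  (forall V b, Big V -> \forall n \near F, Big (V `&` side (f n) r' r b)) ->
  exists n : nat -> nat, [/\ forall k, (0 < n k)%N,
    {homo n : i j / (i < j)%N} & independent (f \o n) r' r].
Proof.
move=> PF Ftail BT Bne Bside.
pose cell (l : seq nat) (b : nat -> bool) :=
  [set t | forall k, (k < size l)%N -> side (f (nth 0 l k)) r' r (b k) t].
pose good l := forall b, Big (cell l b).
(* The premise [good l] sits inside the existential so that [choice] gives a function on all lists.
   Exceeding [sumn l] means exceeding all earlier indices and 0. *)
have extend l : exists n, good l -> (sumn l < n)%N /\ good (rcons l n).
  have [gl|] := pselect (good l); last by exists 0.
  suff : \forall n \near F, (sumn l < n)%N /\ good (rcons l n).
    by move=> /filter_ex[n ?]; exists n.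
  apply: filterS2 (Ftail (sumn l).+1) _; first by move=> n; exact: conj.
  (* A cell depends on finitely many values of [b]; tuples make the quantification finite for
     [filter_forall]. *)
  have : \forall n \near F, forall b : (size l).+1.-tuple bool,
      Big (cell l (nth false b) `&` side (f n) r' r (nth false b (size l))).
    by apply: filter_forall => b; exact: Bside.
  apply: filterS => n + b.
  move=> /(_ [tuple b i | i < (size l).+1]).
  set c := nth _ _; have cE j : (j <= size l)%N -> c j = b j.
    rewrite -ltnS => jl; rewrite /c -[j]/(nat_of_ord (Ordinal jl)).
    by rewrite -tnth_nth tnth_mktuple.
  congr (Big _); apply/seteqP; split=> t /=.
    move=> [tl tn] k; rewrite size_rcons ltnS leq_eqVlt nth_rcons => /predU1P[->|kl].
      by rewrite ltnn eqxx -cE.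
    by rewrite kl -cE ?(ltnW kl)//; exact: tl.
  move=> tl; split=> [k kl|]; last first.
    by have := tl (size l); rewrite size_rcons nth_rcons ltnn eqxx cE//; exact.
  by have := tl k; rewrite size_rcons nth_rcons kl cE ?(ltnW kl)//; apply; exact: ltnW.
have [g gP] := choice extend.
pose L := fix L k := if k is k'.+1 then rcons (L k') (g (L k')) else [::].
have goodL k : good (L k).
  elim: k => [b|k /gP[]//]; rewrite (_ : cell _ _ = setT)//.
  by apply/seteqP; split.
pose n k := g (L k).
have nL k : (sumn (L k) < n k)%N by have [] := gP _ (goodL k).
have sizeL k : size (L k) = k by elim: k => //= k IH; rewrite size_rcons IH.
have nthL k i : (i < k)%N -> nth 0%N (L k) i = n i.
  elim: k => // k IH; rewrite ltnS leq_eqVlt /= nth_rcons sizeL => /predU1P[->|ik].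
    by rewrite ltnn eqxx.
  by rewrite ik IH.
exists n; split.
- by move=> k; exact: leq_ltn_trans (nL k).
- apply: homo_ltn; first exact: ltn_trans.
  move=> k; apply: leq_ltn_trans (nL k.+1) => /=.
  by rewrite -cats1 sumn_cat /= addn0 leq_addl.
- move=> b N; have /Bne[t tN] := goodL N b; exists t => k kN.
  by have := tN k; rewrite sizeL nthL//; exact.
Qed.

(* Evaluating at two points with opposite sign patterns. *)
Lemma independent_l1 (f : nat -> T -> R) (r' r : R) : r' < r ->
  independent f r' r ->
  forall N (a : 'I_N -> R) c, \sum_k `|a k| = 1 ->
    (forall t, `|\sum_k a k * f k t| <= c) -> (r - r') / 2 <= c.
Proof.
move=> rr ind N a c a1 fc.
pose b k := if insub k is Some i then 0 < a i else false.
have bE (k : 'I_N) : b k = (0 < a k) by rewrite /b valK.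
have [t tb] := ind b N; have [s sb] := ind (negb \o b) N.
have : \sum_k `|a k| * (r - r') <= \sum_k (a k * f k t - a k * f k s).
  apply: ler_sum => k _; have := tb k (ltn_ord k); have := sb k (ltn_ord k).
  rewrite /side /= bE; case: ltP => /= ak; rewrite -mulrBr => fs ft.
    by rewrite gtr0_norm// ler_pM2l//; lra.
  by rewrite ler0_norm// mulNr -mulrN ler_wnM2l//; lra.
rewrite -mulr_suml a1 mul1r sumrB => rrts.
have := fc t; have := fc s; rewrite !ler_norml; lra.
Qed.

End independence.

(** * Convergence in measure along ultrafilters *)

Section sublevel.
Context {d : measure_display} {T : measurableType d} {R : realType}.
Variable f : T -> R.
Hypothesis mf : measurable_fun setT f.

Lemma measurable_gtr r : measurable [set t | r < f t].
Proof.
have := mf measurableT (measurable_itv `]r, +oo[).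
by rewrite setTI (_ : _ @^-1` _ = [set t | r < f t])//; apply/seteqP; split=> t /=;
  rewrite in_itv/= andbT.
Qed.

Lemma measurable_ltr r : measurable [set t | f t < r].
Proof.
have := mf measurableT (measurable_itv `]-oo, r[).
by rewrite setTI (_ : _ @^-1` _ = [set t | f t < r])//; apply/seteqP; split=> t /=;
  rewrite in_itv/=.
Qed.

End sublevel.

Section finite_measure.
Context {d : measure_display} {T : measurableType d} {R : realType}.
Variable mu : {measure set T -> \bar R}.
Hypothesis mu_fin : (mu setT < +oo)%E.

Definition rmeas (A : set T) : R := fine (mu A).
Local Notation m := rmeas.

Lemma rmeasE A : measurable A -> mu A = (m A)%:E.
Proof.
move=> mA; rewrite /rmeas fineK// ge0_fin_numE//.
by apply: le_lt_trans mu_fin; rewrite le_measure ?inE.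
Qed.

Lemma rmeas_ge0 A : 0 <= m A.
Proof. exact: fine_ge0. Qed.

Lemma rmeas0 : m set0 = 0.
Proof. by rewrite /rmeas measure0. Qed.

Lemma le_rmeas A B : measurable A -> measurable B -> A `<=` B -> m A <= m B.
Proof.
by move=> mA mB AB; rewrite -lee_fin -!rmeasE// le_measure ?inE.
Qed.

Lemma rmeasU A B : measurable A -> measurable B -> m (A `|` B) <= m A + m B.
Proof.
move=> mA mB; rewrite -lee_fin EFinD -!rmeasE//; last exact: measurableU.
exact: measureU2.
Qed.

Lemma rmeas_disjointU A B : measurable A -> measurable B -> A `&` B = set0 ->
  m (A `|` B) = m A + m B.
Proof.
move=> mA mB AB; apply/EFin_inj; rewrite EFinD -!rmeasE//; last exact: measurableU.
by rewrite measureU.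
Qed.

Lemma rmeas_bigsetU (I : eqType) (s : seq I) (F : I -> set T) (e : R) :
  (forall i, i \in s -> measurable (F i)) ->
  (forall i, i \in s -> m (F i) <= e) ->
  measurable (\big[setU/set0]_(i <- s) F i) /\
  m (\big[setU/set0]_(i <- s) F i) <= (size s)%:R * e.
Proof.
elim: s => [|i s IH] mF Fe; first by rewrite big_nil rmeas0 mul0r.
have [||mU Ue] := IH; try by move=> j js; (apply: mF || apply: Fe); rewrite inE js orbT.
have mi : measurable (F i) by apply: mF; rewrite mem_head.
rewrite big_cons; split; first exact: measurableU.
by rewrite (le_trans (rmeasU mi mU))//= -natr1 mulrDl mul1r addrC lerD// Fe// mem_head.
Qed.

Lemma rmeas_decreasing (F : nat -> set T) (e : R) : 0 < e ->
  (forall n, measurable (F n)) -> (forall n, F n.+1 `<=` F n) ->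
  mu (\bigcap_n F n) = 0%E -> exists N, forall n, (N <= n)%N -> m (F n) < e.
Proof.
move=> e0 mF dF F0.
have : mu \o F @ \oo --> mu (\bigcap_n F n).
  apply: nonincreasing_cvg_mu => //.
  - by rewrite rmeasE// ltry.
  - exact: bigcapT_measurable.
  - by apply/nonincreasing_seqP => n; apply/subsetPset/dF.
rewrite F0 => /fine_cvgP[_ /cvgrPdist_lt/(_ e e0)[N _ NF]].
exists N => n /NF /=; rewrite sub0r normrN ger0_norm//; exact: rmeas_ge0.
Qed.

Lemma null_bigcup (I : set nat) (F : nat -> set T) :
  (forall n, I n -> measurable (F n)) -> (forall n, I n -> m (F n) = 0) ->
  mu (\bigcup_(n in I) F n) = 0%E.
Proof.
move=> mF F0.
have := @negligible_bigcup _ T R mu (fun n => if pselect (I n) then F n else set0).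
have -> : \bigcup_n (if pselect (I n) then F n else set0) = \bigcup_(n in I) F n.
  apply/seteqP; split=> t [n].
    by case: pselect => // In _ ?; exists n.
  by move=> In Fn; exists n => //; case: pselect.
have mU : measurable (\bigcup_(n in I) F n) by exact: bigcup_measurable.
move=> H; apply/(negligibleP mu mU)/H => n.
case: pselect => In; last exact: negligible_set0.
have Fn0 : mu (F n) = 0%E by rewrite (rmeasE (mF n In)) F0.
exact/(negligibleP mu (mF n In)).
Qed.

(** The measures of the [F n] approach the supremum over [C], and a member of [C] disjoint from them
    all could be joined to them, which leaves it no mass. A sequence is produced because [C] will
    not be closed under countable unions. *)
Lemma exhaustion (C : set (set T)) : C set0 ->
  (forall A, C A -> measurable A) -> (forall A B, C A -> C B -> C (A `|` B)) ->
  exists F : nat -> set T, [/\ forall n, C (F n), forall n, F n `<=` F n.+1 &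
    forall A, C A -> A `&` \bigcup_n F n = set0 -> m A = 0].
Proof.
move=> C0 mC CU; pose s := sup [set m A | A in C].
have supC : has_sup [set m A | A in C].
  split; first by exists (m set0), set0.
  by exists (m setT) => _ [A /mC mA <-]; exact: le_rmeas.
have [G GP] : exists G : nat -> set T, forall n, C (G n) /\ s - n.+1%:R^-1 < m (G n).
  suff /choice[G GP] : forall n : nat, exists A, C A /\ s - n.+1%:R^-1 < m A by exists G.
  move=> n; have n0 : 0 < n.+1%:R^-1 :> R by rewrite invr_gt0.
  by have [_ [A CA <-] sA] := sup_adherent n0 supC; exists A.
pose F n := \big[setU/set0]_(i < n.+1) G i.
have CF n : C (F n).
  by rewrite /F; elim/big_ind: _ => // i _; have [] := GP i.
exists F; split=> // [n|A CA AF]; first by rewrite /F [X in _ `<=` X]big_ord_recr; left.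
apply/eqP; rewrite eq_le rmeas_ge0 andbT; apply/ler_addgt0Pr => e e0; rewrite add0r.
have [n ne] : exists n : nat, n.+1%:R^-1 < e.
  have [N _ /(_ N (leqnn _))] := near_infty_natSinv_lt (PosNum e0).
  by exists N.
have [CG sG] := GP n.
have GA : m (A `|` G n) = m A + m (G n).
  apply: rmeas_disjointU; [exact: mC|exact: mC|].
  rewrite -subset0 -AF => t [At Gt]; split=> //; exists n => //.
  by rewrite /F big_ord_recr; right.
have : m (A `|` G n) <= s.
  by apply: sup_upper_bound => //; exists (A `|` G n) => //; exact: CU.
rewrite GA -lerBrDr => /le_trans; apply.
by rewrite lerBlDl -lerBlDr (le_trans _ (ltW sG))// lerD2l lerN2 ltW.
Qed.

End finite_measure.

Arguments rmeas {d T R} mu A.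

Section dichotomy.
Context {d : measure_display} {T : measurableType d} {R : realType}.
Variable mu : {measure set T -> \bar R}.
Hypothesis mu_fin : (mu setT < +oo)%E.
Local Notation m := (rmeas mu).
Variables (f : nat -> T -> R).
Hypothesis mf : forall n, measurable_fun setT (f n).
Variable (U : set_system nat).
Hypotheses (UU : UltraFilter U) (Utail : forall N, \forall n \near U, (N <= n)%N).

Let mside n r' r b : measurable (side (f n) r' r b).
Proof. by case: b; [exact: measurable_gtr|exact: measurable_ltr]. Qed.

(* Exhaust the space by sets on which [f n] stays, along [U], on one side of the gap
   [(r', r)]. If a non-null remainder were left, each of its non-null subsets would meet
   both sides, which is what [independent_subsequence] needs. *)
Lemma ultra_dichotomy (r' r e : R) : 0 < e -> no_independent f r' r ->
  exists V W, [/\ measurable V, measurable W, m (~` (V `|` W)) < e &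
    \forall n \near U, m (V `&` side (f n) r' r true) = 0 /\
                       m (W `&` side (f n) r' r false) = 0].
Proof.
move=> e0 noind.
pose null b := [set V : set T | measurable V /\
  \forall n \near U, m (V `&` side (f n) r' r b) = 0].
have null0 b : null b set0.
  by split=> //; apply: nearW => n; rewrite set0I rmeas0.
have nullU b V W : null b V -> null b W -> null b (V `|` W).
  move=> [mV V0] [mW W0]; split; first exact: measurableU.
  near=> n; rewrite setIUl; apply/eqP; rewrite eq_le rmeas_ge0 andbT.
  rewrite (le_trans (rmeasU mu_fin _ _))//; try exact: measurableI.
  by rewrite (near V0 n)// (near W0 n)// addr0.
pose C := [set A : set T | exists V W, [/\ null true V, null false W & A = V `|` W]].
have [F [CF ndF Fmax]] : exists F : nat -> set T, [/\ forall n, C (F n),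
    forall n, F n `<=` F n.+1 & forall A, C A -> A `&` \bigcup_n F n = set0 -> m A = 0].
  apply: exhaustion => //; first by exists set0, set0; rewrite setU0.
    by move=> _ [V [W [[mV _] [mW _] ->]]]; exact: measurableU.
  move=> _ _ [V1 [W1 [V1n W1n ->]]] [V2 [W2 [V2n W2n ->]]].
  by exists (V1 `|` V2), (W1 `|` W2); rewrite setUACA; split=> //; exact: nullU.
have mF n : measurable (F n).
  by have [V [W [[mV _] [mW _] ->]]] := CF n; exact: measurableU.
have D0 : mu (\bigcap_n ~` F n) = 0%E.
  apply: contrapT => D0; apply: noind.
  set D := \bigcap_n ~` F n in D0.
  have mD : measurable D by apply: bigcapT_measurable => n; exact: measurableC.
  pose Big V := measurable V /\ 0 < m (D `&` V).
  have UP : ProperFilter U by exact: ultra_proper.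
  apply: (@independent_subsequence R T f r' r U Big) => //.
  - split=> //; rewrite setIT lt_neqAle rmeas_ge0 andbT eq_sym.
    by apply/eqP => D0'; apply: D0; rewrite rmeasE// D0'.
  - move=> V [_ mV]; apply/set0P/eqP => V0.
    by move: mV; rewrite V0 setI0 rmeas0 ltxx.
  move=> V b [mV DV0].
  have mDV : measurable (D `&` V) by exact: measurableI.
  (* The ultrafilter decides: if the part of [V] in [D] misses the side up to null sets for [U]-many
     [n], it belongs to [C] and is disjoint from every [F n], hence null. *)
  have [VU|VU] := in_ultra_setVsetC
      [set n | m (D `&` V `&` side (f n) r' r b) = 0] UU.
    suff : m (D `&` V) = 0 by move=> DV; move: DV0; rewrite DV ltxx.
    apply: Fmax; last first.
      by rewrite -subset0 => t [[Dt _] [n _ Fnt]]; exact: (Dt n).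
    case: b VU => VU.
      by exists (D `&` V), set0; rewrite setU0.
    by exists set0, (D `&` V); rewrite set0U.
  near=> n; split; first exact: measurableI.
  rewrite setIA lt_neqAle rmeas_ge0 andbT eq_sym; apply/eqP.
  by near: n.
(* Nullity along [U] may be lost in countable unions, so one [F N] is taken, at the price of a
   remainder of measure below [e]. *)
have [N NF] : exists N, forall n, (N <= n)%N -> m (~` F n) < e.
  apply: rmeas_decreasing => // n; first exact: measurableC.
  by apply: subsetC.
have [V [W [[mV Vn] [mW Wn] FE]]] := CF N.
exists V, W; split=> //; first by rewrite -FE NF.
by near=> n; split; near: n.
Unshelve. all: by end_near. Qed.

(** The dichotomy for [r / 2 < r] leaves, up to [e], a set [V] where [f n <= r] and a set [W] where
    [f n >= r / 2], almost everywhere along [U]. Pointwise smallness on [S] makes [W] null. *)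
Lemma ultra_cvg_measure (S : set T) (r e : R) : 0 < r -> 0 < e ->
  (forall a b, a < b -> no_independent f a b) ->
  measurable S -> mu (~` S) = 0%E ->
  (forall t c, S t -> 0 < c -> \forall n \near U, f n t < c) ->
  \forall n \near U, m [set t | r < f n t] < e.
Proof.
move=> r0 e0 noind mS S0 fS.
have UP : ProperFilter U by exact: ultra_proper.
have rr : r / 2 < r by lra.
have [V [W [mV mW VWe VWU]]] := ultra_dichotomy e0 (noind _ _ rr).
have W0 : m W = 0.
  suff : mu W = 0%E by rewrite /rmeas => ->.
  (* The exceptional null set in [W] varies with [n], but there are only countably many [n], and
     their union contains every point of [W] that lies in [S]. *)
  pose I := [set n | m (W `&` side (f n) (r / 2) r false) = 0].
  have UI : U I by apply: filterS VWU => n [].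
  have N0 : mu (\bigcup_(n in I) (W `&` side (f n) (r / 2) r false)) = 0%E.
    by apply: null_bigcup => // n _; exact: measurableI.
  have mN : measurable (\bigcup_(n in I) (W `&` side (f n) (r / 2) r false)).
    by apply: bigcup_measurable => n _; exact: measurableI.
  apply: (subset_measure0 mW _ _ (null_set_setU (measurableC mS) mN S0 N0)).
    by apply: measurableU => //; exact: measurableC.
  move=> t Wt; have [St|] := pselect (S t); last by left.
  right; have r20 : 0 < r / 2 by lra.
  have Ufn : U [set n | f n t < r / 2] := fS t _ St r20.
  by have [n [In fnt]] := filter_ex (filterI UI Ufn); exists n.
apply: filterS VWU => n [Vn _]; apply: le_lt_trans VWe.
have mn := mside n (r / 2) r true.
(* The inserted zeros are the measures of two of the three sets that cover [[set t | r < f n t]]: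
   the upper side within [V], then [W], then the remainder. *)
rewrite -[leRHS]add0r -[X in _ <= X + _]addr0 -{1}Vn -{1}W0.
have mVn : measurable (V `&` side (f n) (r / 2) r true) by exact: measurableI.
have mC : measurable (~` (V `|` W)) by apply: measurableC; exact: measurableU.
apply: le_trans (lerD (rmeasU mu_fin mVn mW) (lexx _)).
apply: le_trans (rmeasU mu_fin (measurableU _ _ mVn mW) mC).
apply: le_rmeas => //; first by do 2![apply: measurableU => //].
move=> t ft; have [|] := pselect ((V `|` W) t); last by right.
by case=> ?; left; [left|right].
Qed.

(** Values more than [e] apart have a whole interval of a finite grid between them. In the dichotomy
    for that interval, points of [V] have no value above it and points of [W] none below it, up to
    null sets; only the small remainders are left. *)
Lemma ultra_cauchy_measure (c e : R) : 0 < e ->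
  (forall a b, a < b -> no_independent f a b) ->
  (forall n t, `|f n t| <= c) ->
  exists A, U A /\ forall n k, A n -> A k ->
    m [set t | e < `|f n t - f k t| ] < e.
Proof.
move=> e0 noind fc.
have UP : ProperFilter U by exact: ultra_proper.
(* The first level above the smaller value, plus one more step, lies at most [2 * h] above that
   value, which is less than [e]. *)
pose h := e / 4; have h0 : 0 < h by rewrite /h; lra.
pose lev j : R := - c + j%:R * h.
have levS j : lev j.+1 = lev j + h by rewrite /lev -natr1; lra.
have [J cJ] : exists J, c < lev J.
  have [J _ /(_ J (leqnn _)) cJ] := nbhs_infty_gtr (2 * c / h).
  by exists J; move: cJ => /=; rewrite ltr_pdivrMr// /lev; lra.
(* There are [J + 1] remainders; the denominator [J + 2] keeps their sum strictly below [e]. *)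
pose e' := e / J.+2%:R; have e'0 : 0 < e' by rewrite divr_gt0.
have [VW VWP] : exists VW : nat -> set T * set T, forall j,
    [/\ measurable (VW j).1, measurable (VW j).2,
        m (~` ((VW j).1 `|` (VW j).2)) < e' &
     \forall n \near U, m ((VW j).1 `&` side (f n) (lev j) (lev j.+1) true) = 0 /\
       m ((VW j).2 `&` side (f n) (lev j) (lev j.+1) false) = 0].
  suff /choice[VW VWP] : forall j, exists VW, [/\ measurable VW.1, measurable VW.2,
    m (~` (VW.1 `|` VW.2)) < e' &
    \forall n \near U, m (VW.1 `&` side (f n) (lev j) (lev j.+1) true) = 0 /\
       m (VW.2 `&` side (f n) (lev j) (lev j.+1) false) = 0] by exists VW.
  move=> j; have jj : lev j < lev j.+1 by rewrite levS; lra.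
  by have [V [W ?]] := ultra_dichotomy e'0 (noind _ _ jj); exists (V, W).
pose null j n := ((VW j).1 `&` side (f n) (lev j) (lev j.+1) true) `|`
  ((VW j).2 `&` side (f n) (lev j) (lev j.+1) false).
have mnull j n : measurable (null j n).
  by have [? ? _ _] := VWP j; apply: measurableU; exact: measurableI.
exists [set n | forall j : 'I_J.+1, m (null j n) = 0]; split.
  have : \forall n \near U, forall j : 'I_J.+1, m (null j n) = 0.
    apply: filter_forall => j; have [mV mW _ ] := VWP j.
    apply: filterS => n [V0 W0]; apply/eqP; rewrite eq_le rmeas_ge0 andbT.
    rewrite (le_trans (rmeasU mu_fin _ _))//; try exact: measurableI.
    by rewrite V0 W0 addr0.
  by apply: filterS.
move=> n k An Ak.
pose E j := ~` ((VW j).1 `|` (VW j).2) `|` (null j n `|` null j k).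
have mE j : measurable (E j).
  have [mV mW _ _] := VWP j; apply: measurableU; last exact: measurableU.
  by apply: measurableC; exact: measurableU.
have Ee j : j \in iota 0 J.+1 -> m (E j) <= e'.
  rewrite mem_iota/= => jJ; have [mV mW VWe _] := VWP j.
  have mC : measurable (~` ((VW j).1 `|` (VW j).2)).
    by apply: measurableC; exact: measurableU.
  have mnn := mnull j n; have mnk := mnull j k.
  apply: (le_trans (rmeasU mu_fin mC (measurableU _ _ mnn mnk))).
  rewrite -[leRHS]addr0 lerD ?(ltW VWe)//.
  apply: (le_trans (rmeasU mu_fin mnn mnk)).
  by rewrite (An (Ordinal jJ)) (Ak (Ordinal jJ)) addr0.
have [mB Be] := rmeas_bigsetU mu_fin (fun j _ => mE j) Ee.
apply: (@le_lt_trans _ _ (J.+1%:R * e')); last first.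
  by rewrite /e' mulrCA gtr_pMr// ltr_pdivrMr// mul1r ltr_nat.
rewrite size_iota in Be; apply: le_trans Be; apply: le_rmeas => //.
  apply: measurable_gtr; apply: measurableT_comp => //.
  exact: measurable_realfun.measurable_funB.
have gap a b t : f a t < f b t - e -> exists2 j, (j < J.+1)%N &
    f a t < lev j /\ lev j.+1 < f b t.
  move=> ab; have ex : exists j, f a t < lev j.
    by exists J; have := fc a t; rewrite ler_norml; lra.
  have [j aj jmin] := ex_minnP ex; exists j.
    by rewrite ltnS jmin//; have := fc a t; rewrite ler_norml; lra.
  split=> //; case: j aj jmin => [|j] _ jmin.
    by rewrite levS /lev; have := fc a t; rewrite ler_norml /h; lra.
  have ja : lev j <= f a t by rewrite leNgt; apply/negP => /jmin; rewrite ltnn.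
  by rewrite !levS; move: ja ab; rewrite /h; lra.
move=> t /= et.
suff [j jJ Ej] : exists2 j, (j < J.+1)%N & E j t.
  have jI : j \in iota 0 J.+1 by rewrite mem_iota.
  by rewrite -bigcup_seq; exists j.
have [le|le] := leP (f n t) (f k t).
  have [|j jJ [nj jk]] := gap n k t.
    by move: et; rewrite ler0_norm; lra.
  exists j => //; have [[Vt|Wt]|] := pselect (((VW j).1 `|` (VW j).2) t).
  - by right; right; left.
  - by right; left; right.
  - by left.
have [|j jJ [kj jn]] := gap k n t.
  by move: et; rewrite ger0_norm; lra.
exists j => //; have [[Vt|Wt]|] := pselect (((VW j).1 `|` (VW j).2) t).
- by right; left; left.
- by right; right; right.
- by left.
Unshelve. all: by end_near. Qed.

End dichotomy.

Section measure_net.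
Context {d : measure_display} {T : measurableType d} {R : realType}.
Variable mu : {measure set T -> \bar R}.
Hypothesis mu_fin : (mu setT < +oo)%E.

(* Otherwise an ultrafilter containing, for every finite [s], the indices far from [s]
   contradicts [ultra_cauchy_measure]. *)
Lemma measure_net (f : nat -> T -> R) (c e : R) :
  (forall n, measurable_fun setT (f n)) -> 0 < e ->
  (forall a b, a < b -> no_independent f a b) -> (forall n t, `|f n t| <= c) ->
  exists s : seq nat, forall n, exists2 k, k \in s &
    rmeas mu [set t | e < `|f n t - f k t| ] < e.
Proof.
move=> mf e0 noind fc; apply: contrapT => nonet.
pose far (s : seq nat) := [set n | forall k, k \in s ->
  ~ rmeas mu [set t | e < `|f n t - f k t| ] < e].
have far0 s : far s !=set0.
  apply: contrapT => s0; apply: nonet; exists s => n; apply: contrapT => nk.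
  by apply: s0; exists n => k ks nks; apply: nk; exists k.
have PF : ProperFilter (filter_from setT far).
  apply: filter_from_proper; last by move=> s _; exact: far0.
  apply: filter_from_filter; first by exists [::].
  move=> s1 s2 _ _; exists (s1 ++ s2) => // n ns.
  by split=> k ks; apply: ns; rewrite mem_cat ks ?orbT.
have [U [UU sU]] := ultraFilterLemma PF.
have Ufar s : U (far s) by apply: sU; exists s.
(* Each [f n] is at distance zero from itself, so [far] of an initial segment excludes that
   segment. *)
have Utail N : \forall n \near U, (N <= n)%N.
  apply: filterS (Ufar (iota 0 N)) => n; rewrite leqNgt => farn; apply/negP => nN.
  apply: (farn n); first by rewrite mem_iota.
  rewrite (_ : mkset _ = set0) ?rmeas0//; apply/seteqP; split=> t //=.
  by rewrite subrr normr0 ltNge (ltW e0).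
have [A [UA Ae]] := ultra_cauchy_measure mu_fin mf UU Utail e0 noind fc.
have [n An] := filter_ex UA.
have [k [Ak nk]] := filter_ex (filterI UA (Ufar [:: n])).
by apply: (nk n); [rewrite mem_head|exact: Ae].
Qed.

End measure_net.

(** * Functionals on C(Omega) and their total variation *)

(** The distance to [A], or the constant 1 when [A] is empty and the infimum would range over
    nothing. *)
Lemma closed_zero_set (R : realType) (Omega : pmetricType R) (A : set Omega) :
  closed A -> exists d : Omega -> R,
    [/\ continuous d, forall w, 0 <= d w & forall w, d w = 0 <-> A w].
Proof.
move=> cA; have [->|/set0P[a0 Aa0]] := eqVneq A set0.
  exists (fun=> 1); split=> // [w|w]; first exact: cvg_cst.
  by split=> // /eqP; rewrite oner_eq0.
pose D w := [set mdist w a | a in A].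
have infD w : has_inf (D w).
  split; first by exists (mdist w a0), a0.
  by exists 0 => _ [a _ <-]; exact: mdist_ge0.
pose d w := inf (D w).
have d_ge0 w : 0 <= d w.
  by apply: lb_le_inf; [exact: (infD w).1|move=> _ [a _ <-]; exact: mdist_ge0].
have d_lip w w' : d w <= mdist w w' + d w'.
  rewrite -lerBlDl; apply: lb_le_inf; first exact: (infD w').1.
  move=> _ [a Aa <-]; rewrite lerBlDl (le_trans _ (metric_triangle _ w' _))//.
  by apply: ge_inf; [exact: (infD w).2|exists a].
exists d; split=> // w.
  apply/cvgrPdist_lt => e e0; apply/nbhs_ballP; exists e => //= w' ww'.
  have {}ww' : mdist w w' < e by move: ww'; rewrite ballEmdist.
  apply: le_lt_trans ww'; rewrite ler_norml; apply/andP; split.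
    by have := d_lip w' w; rewrite metric_sym; lra.
  by have := d_lip w w'; lra.
split=> [dw0|Aw]; last first.
  apply/eqP; rewrite eq_le d_ge0 andbT -(mdistxx w).
  by apply: ge_inf; [exact: (infD w).2|exists w].
apply: cA => B /nbhs_ballP[e /= e0 eB].
have [_ [a Aa <-] ae] := inf_adherent e0 (infD w).
exists a; split=> //; apply: eB; rewrite ballEmdist /=.
by rewrite -[inf _]/(d w) dw0 add0r in ae.
Qed.

Lemma continuous_bigsum (R : realType) (Omega : topologicalType) (I : Type)
    (s : seq I) (F : I -> Omega -> R) :
  (forall i, continuous (F i)) -> continuous (fun w => \sum_(i <- s) F i w).
Proof.
move=> cF; elim: s => [|i s IH] w.
  have -> : (fun w => \sum_(i <- [::]) F i w) = (fun=> 0).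
    by apply/funext => v; rewrite big_nil.
  exact: cvg_cst.
have -> : (fun w => \sum_(j <- i :: s) F j w) =
    (fun w => F i w + \sum_(j <- s) F j w).
  by apply/funext => v; rewrite big_cons.
by apply: cvgD; [exact: cF|exact: IH].
Qed.

Section bounded_functional.
Context {R : realType} {Omega : pmetricType R}.
Hypothesis cO : compact [set: Omega].

Lemma continuous_bounded (f : Omega -> R) : continuous f ->
  exists2 c, 0 <= c & forall w, `|f w| <= c.
Proof.
move=> cf; have /compact_bounded := continuous_compact (continuous_subspaceT cf) cO.
move=> [c [_ cP]]; exists (`|c| + 1); first by rewrite addr_ge0.
move=> w; apply: (cP (`|c| + 1)); last by exists w.
by rewrite (le_lt_trans (ler_norm c))// ltrDl.
Qed.

(** The laws bind continuous arguments only: a functional has a plain function type and arbitrary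
    values elsewhere. *)
Definition bounded_functional (l : (Omega -> R) -> R) (M : R) : Prop :=
  [/\ forall f g : Omega -> R, continuous f -> continuous g ->
        l (fun w => f w + g w) = l f + l g,
      forall a (f : Omega -> R), continuous f -> l (fun w => a * f w) = a * l f &
      forall (f : Omega -> R) (c : R), continuous f ->
        (forall w, `|f w| <= c) -> `|l f| <= M * c].

Variables (l : (Omega -> R) -> R) (M : R).
Hypothesis lP : bounded_functional l M.

Let lD := let: And3 P _ _ := lP in P.
Let lZ := let: And3 _ P _ := lP in P.
Let lM := let: And3 _ _ P := lP in P.

Let l0 : l (fun=> 0) = 0.
Proof.
rewrite [X in l X](_ : _ = (fun w => 0 * (fun=> 0) w)).
  by rewrite lZ ?mul0r// => w; exact: cvg_cst.
by apply/funext => w; rewrite mul0r.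
Qed.

Let lN (f : Omega -> R) : continuous f -> l (fun w => - f w) = - l f.
Proof.
move=> cf; rewrite -mulN1r -lZ//; congr l; apply/funext => w.
by rewrite mulN1r.
Qed.

Let lB (f g : Omega -> R) : continuous f -> continuous g ->
  l (fun w => f w - g w) = l f - l g.
Proof.
by move=> cf cg; rewrite lD ?lN// => w; apply: continuousN; exact: cg.
Qed.

Let M_ge0 : 0 <= M.
Proof.
have c1 : continuous (fun _ : Omega => 1 : R) by move=> w; exact: cvg_cst.
have := @lM (fun=> 1) 1 c1 _; rewrite mulr1 => H; apply: (le_trans _ (H _)) => //.
by move=> _; rewrite normr1.
Qed.

Definition test (U : set Omega) (f : Omega -> R) : Prop :=
  [/\ continuous f, forall w, `|f w| <= 1 & forall w, ~ U w -> f w = 0].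

(** For open [U], the total variation on [U] of the signed measure representing [l]. Tests merely
    vanish off [U]; soft thresholding brings them back to a compact subset of [U]. *)
Definition variation (U : set Omega) : R := sup [set l f | f in test U].

Lemma test0 U : test U (fun=> 0).
Proof. by split=> // [w|w]; [exact: cvg_cst|rewrite normr0]. Qed.

Let has_sup_test U : has_sup [set l f | f in test U].
Proof.
split; first by exists (l (fun=> 0)), (fun=> 0) => //; exact: test0.
exists M => _ [f [cf f1 _] <-]; apply: (le_trans (ler_norm _)).
by rewrite -[M]mulr1; exact: lM.
Qed.

Let variation_ub U f : test U f -> l f <= variation U.
Proof. by move=> Uf; apply: sup_upper_bound => //; exists f. Qed.

Lemma variation_ge0 U : 0 <= variation U.
Proof. by rewrite -l0; exact: variation_ub (test0 U). Qed.

Let variation_le U c : (forall f, test U f -> l f <= c) -> variation U <= c.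
Proof.
move=> h; apply: ge_sup; first exact: (has_sup_test U).1.
by move=> _ [f Uf <-]; exact: h.
Qed.

Lemma variation_leM U : variation U <= M.
Proof.
apply: variation_le => f [cf f1 _]; apply: (le_trans (ler_norm _)).
by rewrite -[M]mulr1; exact: lM.
Qed.

Lemma le_variation U V : U `<=` V -> variation U <= variation V.
Proof.
move=> UV; apply: variation_le => f [cf f1 f0]; apply: variation_ub; split=> // w Vw.
by apply: f0 => /UV.
Qed.

Lemma variation_scale U c f : continuous f -> (forall w, `|f w| <= c) ->
  (forall w, ~ U w -> f w = 0) -> `|l f| <= c * variation U.
Proof.
move=> cf fc f0.
suff le (g : Omega -> R) : continuous g -> (forall w, `|g w| <= c) ->
    (forall w, ~ U w -> g w = 0) -> l g <= c * variation U.
  rewrite ler_norml le// andbT lerNl -lN//; apply: le.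
  - by move=> w; apply: continuousN; exact: cf.
  - by move=> w; rewrite normrN.
  - by move=> w /f0 ->; rewrite oppr0.
move=> cg gc g0; have c0 : 0 <= c by exact: le_trans (gc point).
have [cz|cn0] := eqVneq c 0.
  rewrite cz mul0r (_ : g = fun=> 0) ?l0//; apply/funext => w.
  by apply/eqP; rewrite -normr_le0 -cz.
have cp : 0 < c by rewrite lt_neqAle eq_sym cn0.
have -> : l g = c * l (fun w => c^-1 * g w) by rewrite lZ// mulrA divff// mul1r.
rewrite ler_wpM2l// variation_ub//; split=> [w|w|w /g0 ->]; last by rewrite mulr0.
- by apply: cvgM; [exact: cvg_cst|exact: cg].
- by rewrite normrM gtr0_norm ?invr_gt0// mulrC ler_pdivrMr// mul1r.
Qed.

(* Soft thresholding: [x] minus its truncation to [[-e, e]]. *)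
Definition soft (e x : R) : R := x - (`|x + e| - `|x - e|) / 2.

Lemma soft_continuous (e : R) (f : Omega -> R) : continuous f ->
  continuous (fun w : Omega => soft e (f w)).
Proof.
move=> cf w; apply: cvgB; first exact: cf.
apply: cvgMl; apply: cvgB; apply: cvg_norm; [apply: cvgD|apply: cvgB];
  by [exact: cf|exact: cvg_cst].
Qed.

Let soft_cases (e x : R) : 0 <= e ->
  [\/ `|x| <= e /\ soft e x = 0, e < x /\ soft e x = x - e | x < - e /\ soft e x = x + e].
Proof.
move=> e0; rewrite /soft; have [xe|xe] := leP x e; last first.
  by apply: Or32; split=> //; rewrite !ger0_norm; lra.
rewrite (@ler0_norm _ (x - e)); last lra.
have [xe'|xe'] := leP (- e) x.
  by apply: Or31; rewrite (@ger0_norm _ (x + e)) ?ler_norml; [split|]; lra.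
by apply: Or33; split=> //; rewrite (@ler0_norm _ (x + e)); lra.
Qed.

Lemma soft_le (e x : R) : 0 <= e -> `|soft e x| <= `|x|.
Proof.
move=> e0; have [[_ ->]|[h ->]|[h ->]] := soft_cases x e0.
- by rewrite normr0.
- by rewrite !ger0_norm; lra.
- by rewrite !ler0_norm; lra.
Qed.

Lemma soft_dist (e x : R) : 0 <= e -> `|x - soft e x| <= e.
Proof.
move=> e0; have [[h ->]|[h ->]|[h ->]] := soft_cases x e0; first by rewrite subr0.
- by rewrite ler_norml; lra.
- by rewrite ler_norml; lra.
Qed.

Lemma soft_eq0 (e x : R) : `|x| <= e -> soft e x = 0.
Proof.
move=> xe; have e0 : 0 <= e by exact: le_trans xe.
move: xe; rewrite ler_norml => /andP[? ?].
by have [[_ ->]|[? _]|[? _]] := soft_cases x e0; lra.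
Qed.

Lemma functional_soft (e : R) (f : Omega -> R) : 0 <= e -> continuous f ->
  `|l f - l (fun w => soft e (f w))| <= M * e.
Proof.
move=> e0 cf; have cs := soft_continuous (e := e) cf.
rewrite -lB//; apply: lM => w; last exact: soft_dist.
by apply: cvgB; [exact: cf|exact: cs].
Qed.

Let closed_norm_ge (f : Omega -> R) (e : R) : continuous f -> closed [set w | e <= `|f w|].
Proof.
move=> cf; apply: (@closed_comp _ R (fun w => `|f w|) [set x | e <= x]).
  by move=> w _; apply: cvg_norm; exact: cf.
exact: closed_ge.
Qed.

Let l_sum (I : Type) (s : seq I) (F : I -> Omega -> R) :
  (forall i, continuous (F i)) ->
  l (fun w => \sum_(i <- s) F i w) = \sum_(i <- s) l (F i).
Proof.
move=> cF; elim: s => [|i s IH].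
  by rewrite big_nil -[RHS]l0; congr l; apply/funext => w; rewrite big_nil.
rewrite big_cons -IH -lD//; last exact: continuous_bigsum.
by congr l; apply/funext => w; rewrite big_cons.
Qed.

(* A partition of unity subordinate to finitely many of the [U n] on the compact
   set where [`|f| >= e], multiplied by the soft thresholding of [f]. *)
Lemma variation_bigcup_test (U : nat -> set Omega) f (e : R) :
  (forall n, open (U n)) -> test (\bigcup_n U n) f -> 0 < e ->
  exists N, l f <= M * e + \sum_(i < N) variation (U i).
Proof.
move=> oU [cf f1 f0] e0.
pose K := [set w | e <= `|f w|].
have cK : closed K by exact: closed_norm_ge.
have [D' _ KD'] : finite_subset_cover setT U K.
  have kK : compact K := subclosed_compact cK cO (@subsetT _ K).
  move: kK; rewrite compact_cover; apply; first by move=> i _.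
  move=> w Kw; have [n _ Unw] : (\bigcup_n U n) w.
    apply: contrapT => /f0 fw; move: Kw; rewrite /K /= fw normr0.
    by rewrite leNgt e0.
  by exists n.
pose N := (\max_(i <- finmap.enum_fset D') i).+1.
have KN w : K w -> exists2 i, (i < N)%N & U i w.
  by move=> /KD'[i iD' Uiw]; exists i => //; rewrite ltnS; exact: leq_bigmax_seq.
have [d dP] : exists d : nat -> Omega -> R, forall n,
    [/\ continuous (d n), forall w, 0 <= d n w & forall w, d n w = 0 <-> (~` U n) w].
  suff /choice[d dP] : forall n, exists d : Omega -> R,
    [/\ continuous d, forall w, 0 <= d w & forall w, d w = 0 <-> (~` U n) w] by exists d.
  by move=> n; apply: closed_zero_set; exact: open_closedC.
(* [dK] keeps the denominator positive off [K]. On [K] it vanishes, so the quotients sum to 1 there;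
   off [K] the thresholded function is zero. *)
have [dK [cdK dK0 dKP]] := closed_zero_set cK.
pose D w := \sum_(i < N) d i w.
have D_ge0 w : 0 <= D w by apply: sumr_ge0 => i _; have [] := dP i.
have DK w : 0 < D w + dK w.
  rewrite lt_neqAle addr_ge0// andbT eq_sym paddr_eq0// negb_and.
  have [/KN[i iN Uiw]|Kw] := pselect (K w); last first.
    by apply/orP; right; apply/eqP => /dKP.
  apply/orP; left; apply/eqP => D0; have [_ _ dU] := dP i.
  suff /dU : d i w = 0 by [].
  have d0 (j : 'I_N) : xpredT j -> 0 <= d j w by have [] := dP j.
  exact: (psumr_eq0P d0 D0 (i := Ordinal iN) isT).
have cD : continuous D by apply: continuous_bigsum => i; have [] := dP i.
pose F (i : 'I_N) w := soft e (f w) * (d i w / (D w + dK w)).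
have cs := soft_continuous (e := e) cf.
have cF i : continuous (F i).
  have [cd _ _] := dP i; move=> w; apply: cvgM; first exact: cs.
  apply: cvgM; first exact: cd.
  by apply: cvgV; [exact: lt0r_neq0|apply: cvgD; [exact: cD|exact: cdK]].
have testF (i : 'I_N) : test (U i) (F i).
  have [_ d0 dU] := dP i; split=> // [w|w Uw]; last first.
    by rewrite /F ((dU w).2 Uw) mul0r mulr0.
  rewrite normrM -[leRHS]mulr1 ler_pM//.
    by rewrite (le_trans (soft_le _ (ltW e0))).
  rewrite ger0_norm; last by rewrite divr_ge0// ltW.
  rewrite ler_pdivrMr// mul1r /D (bigD1 i)//= -addrA lerDl addr_ge0//.
  by apply: sumr_ge0 => j _; have [] := dP j.
have sF : (fun w => soft e (f w)) = (fun w => \sum_i F i w).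
  apply/funext => w; rewrite -mulr_sumr -mulr_suml.
  have [Kw|Kw] := pselect (K w).
    rewrite ((dKP w).2 Kw) addr0 divff ?mulr1//.
    by have := DK w; rewrite ((dKP w).2 Kw) addr0 => /lt0r_neq0.
  by rewrite soft_eq0 ?mul0r// ltW// ltNge; apply/negP.
exists N; have := functional_soft (ltW e0) cf; rewrite ler_norml => /andP[_].
rewrite lerBlDr => /le_trans; apply; rewrite lerD2l sF l_sum//.
by apply: ler_sum => i _; exact: variation_ub.
Qed.

(** After thresholding, a nearly optimal test function on the intersection of [W] and [V] vanishes
    off a closed [K] inside it, so any test function on [W] minus [K] can be added without exceeding
    1. That open set stands in for [W] minus [V]. *)
Lemma variation_split W V : open W -> open V -> forall e : R, 0 < e ->
  exists W', [/\ open W', W `&` ~` V `<=` W' &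
    variation (W `&` V) + variation W' <= variation W + e].
Proof.
move=> oW oV e e0; have M0 := M_ge0.
(* Near-optimality costs [e'], thresholding [M * e']. *)
pose e' := e / (M + 2); have e'0 : 0 < e' by rewrite divr_gt0//; lra.
have Me' : M * e' + e' <= e.
  rewrite -{2}[e'](mul1r e') -mulrDl /e' mulrCA ger_pMr//.
  by rewrite ler_pdivrMr; lra.
have [_ [f1 [cf1 f11 f10] <-] lf1] := sup_adherent e'0 (has_sup_test (W `&` V)).
pose K := [set w | e' <= `|f1 w|].
have cK : closed K by exact: closed_norm_ge.
have KWV w : K w -> (W `&` V) w.
  move=> Kw; apply: contrapT => /f10 fw; move: Kw; rewrite /K /= fw normr0.
  by rewrite leNgt e'0.
exists (W `&` ~` K); split.
- by apply: openI => //; exact: closed_openC.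
- by move=> w [Ww Vw]; split=> // /KWV[].
have cs := soft_continuous (e := e') cf1.
have lfs := functional_soft (ltW e'0) cf1.
suff : variation (W `&` ~` K) <= variation W - l (fun w => soft e' (f1 w)).
  by move: lfs lf1 Me'; rewrite -/(variation _) ler_norml; lra.
apply: variation_le => f2 [cf2 f21 f20]; rewrite lerBrDl -lD//.
apply: variation_ub; split=> [w|w|w Ww]; first by apply: cvgD; [exact: cs|exact: cf2].
- have [Kw|Kw] := pselect (K w).
    rewrite f20 ?addr0; last by move=> [].
    exact: le_trans (soft_le _ (ltW e'0)) _.
  by rewrite soft_eq0 ?add0r// ltW// ltNge; apply/negP.
- rewrite f20; last by move=> [].
  rewrite addr0 soft_eq0// f10; last by move=> [].
  by rewrite normr0 ltW.
Qed.

End bounded_functional.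

(* The total variation as a Borel measure *)
From HB Require Import structures.

(** Borel sets lie in the sigma-algebra of Caratheodory sets. As a function [mu] is [nu] itself,
    hence the equality on arbitrary sets. *)
Lemma outer_measure_borel (R : realType) (Omega : pmetricType R)
    (nu : {outer_measure set Omega -> \bar R}) :
  (forall U, open U -> (caratheodory_measurable nu) U) ->
  exists mu : {measure set (borel Omega) -> \bar R}, forall A, mu A = nu A.
Proof.
move=> oU.
have sub : (@measurable _ (borel Omega)) `<=` (@measurable _ (caratheodory_type nu)).
  apply: smallest_sub; last by move=> U /oU.
  split; [exact: measurable0|by move=> X mX; rewrite setTD; exact: measurableC|].
  by move=> F mF; exact: bigcupT_measurable.
have sa : semi_sigma_additive (nu : set (borel Omega) -> \bar R).
  move=> F mF tF mUF; apply: caratheodory_measure_sigma_additive => //.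
    by move=> i; exact: sub.
  exact: sub.
pose mu_ := isMeasure.Build _ (borel Omega) R (nu : set (borel Omega) -> \bar R)
  (outer_measure0 nu) (outer_measure_ge0 nu) sa.
pose mu : {measure set (borel Omega) -> \bar R} :=
  HB.pack_for {measure set (borel Omega) -> \bar R} (nu : set (borel Omega) -> \bar R) mu_.
by exists mu.
Qed.

Section dominating_measure.
Context {R : realType} {Omega : pmetricType R}.
Hypothesis cO : compact [set: Omega].
Variables (l : (Omega -> R) -> R) (M : R).
Hypothesis lP : bounded_functional l M.
Local Notation var := (variation l).
Local Open Scope ereal_scope.

Let outer (A : set Omega) : \bar R :=
  ereal_inf [set (var U)%:E | U in [set U | open U /\ A `<=` U]].

Let outer_open U : open U -> outer U = (var U)%:E.
Proof.
move=> oU; apply/eqP; rewrite eq_le; apply/andP; split.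
  by apply: ereal_inf_lbound; exists U => //; split.
apply: le_ereal_inf_tmp => _ [V [oV UV] <-]; rewrite lee_fin.
exact: (le_variation lP).
Qed.

Let outer_le A B : A `<=` B -> outer A <= outer B.
Proof.
move=> AB; apply: le_ereal_inf_tmp => _ [V [oV BV] <-].
apply: ereal_inf_lbound; exists V => //; split; first exact: oV.
exact: subset_trans BV.
Qed.

Let outer_ge0 A : 0 <= outer A.
Proof.
apply: le_ereal_inf_tmp => _ [V _ <-]; rewrite lee_fin; exact: (variation_ge0 lP).
Qed.

Let outer_fin A : outer A \is a fin_num.
Proof.
rewrite ge0_fin_numE// (le_lt_trans (outer_le (@subsetT _ A)))//.
by rewrite outer_open ?ltry//; exact: openT.
Qed.

Let outer0 : outer set0 = 0.
Proof.
rewrite outer_open; last exact: open0.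
congr EFin; apply/eqP; rewrite eq_le (variation_ge0 lP) andbT.
apply: ge_sup.
  by exists (l (fun=> 0%R)), (fun=> 0%R) => //; exact: test0.
move=> _ [f [cf _ f0] <-]; have [_ _ lM] := lP.
have := lM f 0%R cf; rewrite mulr0 => lf0; apply: (le_trans (ler_norm _) (lf0 _)).
by move=> w; rewrite f0// normr0.
Qed.

Let outer_approx A (e : R) : (0 < e)%R ->
  exists U, [/\ open U, A `<=` U & (var U)%:E <= outer A + e%:E].
Proof.
move=> e0; have [_ [U [oU AU] <-] Ue] := lb_ereal_inf_adherent e0 (outer_fin A).
by exists U; split=> //; exact: ltW.
Qed.

(** Open supersets within [e / 2 ^ n.+1] reduce this to open sets, where [variation_bigcup_test]
    bounds each test function by finitely many terms of the series. *)
Let outer_sigma_subadditive : sigma_subadditive outer.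
Proof.
move=> F.
suff add2e (e : {posnum R}) :
    outer (\bigcup_n F n) <= \sum_(i <oo) outer (F i) + e%:num%:E.
  by apply/lee_addgt0Pr => _/posnumP[].
rewrite (le_trans _ (epsilon_trick _ _ _))//.
have [U UP] : exists U : nat -> set Omega, forall n, [/\ open (U n), F n `<=` U n &
    (var (U n))%:E <= outer (F n) + (e%:num / (2 ^ n.+1)%:R)%:E].
  suff /choice[U UP] : forall n : nat, exists U, [/\ open U, F n `<=` U &
      (var U)%:E <= outer (F n) + (e%:num / (2 ^ n.+1)%:R)%:E] by exists U.
  by move=> n; apply: outer_approx.
have oUU : open (\bigcup_n U n) by apply: bigcup_open => n _; have [] := UP n.
have FU : \bigcup_n F n `<=` \bigcup_n U n.
  by apply: subset_bigcup => n _; have [] := UP n.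
apply: (le_trans (outer_le FU)); rewrite outer_open//.
apply: (@le_trans _ _ (\sum_(i <oo) (var (U i))%:E)); last first.
  apply: lee_nneseries => n _; last by have [] := UP n.
  by rewrite lee_fin (variation_ge0 lP).
apply/lee_addgt0Pr => c c0.
have M0 : (0 <= M)%R := le_trans (variation_ge0 lP setT) (variation_leM lP setT).
pose c' := (c / (M + 1))%R; have c'0 : (0 < c')%R by rewrite divr_gt0//; lra.
have Mc : (M * c' <= c)%R.
  by rewrite /c' mulrCA ger_pMr// ler_pdivrMr; lra.
have S0 : 0 <= \sum_(i <oo) (var (U i))%:E.
  by apply: nneseries_ge0 => n _ _; rewrite lee_fin (variation_ge0 lP).
have [->|Soo] := eqVneq (\sum_(i <oo) (var (U i))%:E) +oo.
  by rewrite addye ?leey.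
have Sfin : \sum_(i <oo) (var (U i))%:E \is a fin_num.
  by rewrite ge0_fin_numE// ltey.
rewrite -(fineK Sfin) -EFinD lee_fin; apply: ge_sup.
  by exists (l (fun=> 0%R)), (fun=> 0%R) => //; exact: test0.
move=> _ [f Uf <-]; have oU n : open (U n) by have [] := UP n.
have [N lf] := variation_bigcup_test cO lP oU Uf c'0.
rewrite (le_trans lf)// addrC lerD// -lee_fin fineK// -sumEFin.
rewrite -(big_mkord xpredT (fun i => (var (U i))%:E)).
by apply: nneseries_lim_ge => n _ _; rewrite lee_fin (variation_ge0 lP).
Qed.

Let outer_caratheodory U : open U -> forall A,
  outer (A `&` U) + outer (A `&` ~` U) <= outer A.
Proof.
move=> oU A; apply/lee_addgt0Pr => e e0.
have e20 : (0 < e / 2)%R by rewrite divr_gt0.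
have [W [oW AW We]] := outer_approx A e20.
have [W' [oW' WW' le]] := variation_split lP oW oU e20.
apply: (@le_trans _ _ (outer (W `&` U) + outer W')).
  by apply: leeD; apply: outer_le; [exact: setSI|apply: subset_trans WW'; exact: setSI].
rewrite (outer_open (openI oW oU)) (outer_open oW').
have le' : (var (W `&` U))%:E + (var W')%:E <= (var W)%:E + (e / 2)%:E.
  by rewrite -!EFinD lee_fin; exact: le.
apply: (le_trans le'); rewrite [e in leRHS]splitr EFinD addeA leeD2r//.
Qed.

(** The second clause locates the mass: it will make the complement of an orbit closure null. The
    third stands for integration: thresholding [f] at [e] costs at most [M * e], and what remains
    vanishes where |f| <= e. *)
Lemma dominating_measure : exists mu : {measure set (borel Omega) -> \bar R},
  [/\ mu setT < +oo,
    forall U, open U -> (forall f : Omega -> R, continuous f ->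
      (forall w, ~ U w -> f w = 0%R) -> l f = 0%R) -> mu U = 0 &
    forall (f : Omega -> R) c e, continuous f -> (forall w, `|f w| <= c)%R ->
      (0 <= e)%R -> (`|l f| <= M * e + c * rmeas mu [set w | e < `|f w|])%R].
Proof.
have H := isOuterMeasure.Build R Omega outer outer0 outer_ge0 outer_le
  outer_sigma_subadditive.
pose nu : {outer_measure set Omega -> \bar R} :=
  HB.pack_for {outer_measure set Omega -> \bar R} outer H.
have [|mu muE] := @outer_measure_borel R Omega nu.
  by move=> U oU; apply: le_caratheodory_measurable; exact: outer_caratheodory.
exists mu; split.
- by rewrite muE -ge0_fin_numE//; exact: outer_fin.
- move=> U oU lU; rewrite muE /= outer_open//; congr EFin; apply/eqP.
  rewrite eq_le (variation_ge0 lP) andbT; apply: ge_sup.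
    by exists (l (fun=> 0%R)), (fun=> 0%R) => //; exact: test0.
  by move=> _ [f [cf _ f0] <-]; rewrite lU.
move=> f c e cf fc e0.
have -> : rmeas mu [set w | e < `|f w|]%R = var [set w | e < `|f w|]%R.
  rewrite /rmeas muE /= outer_open//.
  apply: (@open_comp _ _ (fun w => `|f w|)%R [set x | e < x]%R); last exact: open_gt.
  by move=> w _; apply: cvg_norm; exact: cf.
rewrite -[X in `|X|%R](subrK (l (fun w => soft e (f w)))).
rewrite (le_trans (ler_normD _ _))// lerD//; first exact: functional_soft.
apply: (variation_scale lP); first exact: soft_continuous.
  by move=> w; rewrite (le_trans (soft_le _ e0)).
by move=> w /negP; rewrite -leNgt => /soft_eq0.
Qed.

End dominating_measure.

(** * Recurrence to minimal sets *)

Section semicascade.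
Context {R : realType} {Omega : pmetricType R}.
Hypothesis cO : compact [set: Omega].
Variable phi : Omega -> Omega.
Hypothesis cphi : continuous phi.

Lemma iter_continuous n : continuous (iter n phi).
Proof.
elim: n => [|n IH] w; first exact: cvg_id.
by apply: (@continuous_comp _ _ _ (iter n phi) phi); [exact: IH|exact: cphi].
Qed.

Lemma comp_iter_continuous (x : Omega -> R) n :
  continuous x -> continuous (fun w => x (iter n phi w)).
Proof.
move=> cx w; apply: (@continuous_comp _ _ _ (iter n phi) x); last exact: cx.
exact: iter_continuous.
Qed.

Lemma open_iter n (V : set Omega) : open V -> open (iter n phi @^-1` V).
Proof. by apply: open_comp => w _; exact: iter_continuous. Qed.

Lemma measurable_continuous (x : Omega -> R) :
  continuous x -> measurable_fun setT (x : borel Omega -> R).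
Proof.
move=> cx; apply: (measurability _ (RGenOpens.measurableE R)).
move=> _ [_ [a [b ->] <-]]; rewrite setTI; apply: sub_sigma_algebra.
by apply: open_comp => [w _|]; [exact: cx|exact: interval_open].
Qed.

Lemma orbit_closure_iter w n : orbit_closure phi w (iter n phi w).
Proof. by apply: subset_closure; exists n. Qed.

Lemma orbit_closure_sub (S : set Omega) z :
  closed S -> (forall w, S w -> S (phi w)) -> S z -> orbit_closure phi z `<=` S.
Proof.
move=> cS pS Sz; apply: subset_trans cS; apply: closureS.
by move=> _ [n _ <-]; elim: n => //= n; exact: pS.
Qed.

Lemma orbit_closure_invariant z w :
  orbit_closure phi z w -> orbit_closure phi z (phi w).
Proof.
move=> zw B Bw; have [_ [[n _ <-] Bn]] := zw _ (cphi Bw).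
by exists (iter n.+1 phi z); split=> //; exists n.+1.
Qed.

Lemma orbit_closure_hits z w (O : set Omega) :
  orbit_closure phi z w -> open O -> O w -> exists n, O (iter n phi z).
Proof.
move=> zw oO Ow; have [_ [[n _ <-] On]] := zw _ (open_nbhs_nbhs (conj oO Ow)).
by exists n.
Qed.

Lemma uniform_hitting (S O : set Omega) : closed S -> open O ->
  (forall z, S z -> exists n, O (iter n phi z)) ->
  exists J, forall z, S z -> exists2 j, (j <= J)%N & O (iter j phi z).
Proof.
move=> cS oO SO; have kS : compact S := subclosed_compact cS cO (@subsetT _ S).
have [D _ SD] : finite_subset_cover setT (fun n => iter n phi @^-1` O) S.
  move: kS; rewrite compact_cover; apply; first by move=> n _; exact: open_iter.
  by move=> z /SO[n On]; exists n.
exists (\max_(i <- finmap.enum_fset D) i) => z /SD[j jD Oj].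
by exists j => //; exact: leq_bigmax_seq.
Qed.

(* Points whose orbit closures contain [m] are brought into any neighborhood of [m]
   one after the other, staying there for as long as the next one needs. *)
Lemma simultaneous_hitting (S m O : set Omega) (F : seq Omega) N : closed S ->
  (forall w, S w -> S (phi w)) -> (forall w, m w -> m (phi w)) -> m !=set0 ->
  (forall z, S z -> m `<=` orbit_closure phi z) ->
  open O -> m `<=` O -> (forall z, z \in F -> S z) ->
  exists2 n, (N <= n)%N & forall z, z \in F -> O (iter n phi z).
Proof.
move=> cS pS pm [w0 mw0] mS; elim: F O => [|z F IH] O oO mO FS; first by exists N.
have [J JP] : exists J, forall z, S z -> exists2 j, (j <= J)%N & O (iter j phi z).
  apply: uniform_hitting => // w Sw.
  by apply: (@orbit_closure_hits w w0) => //; [exact: mS|exact: mO].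
pose O' := \big[setI/setT]_(j < J.+1) (iter j phi @^-1` O).
have O'E w : O' w <-> forall j, (j <= J)%N -> O (iter j phi w).
  rewrite /O' -(bigcap_mkord J.+1 (fun j => iter j phi @^-1` O)).
  split=> [h j jJ|h j /= jJ]; first exact: (h j).
  exact: h.
have [|||n Nn nO'] := IH O'.
- rewrite /O'; elim/big_ind: _ => [|? ? ? ?|j _];
    [exact: openT|exact: openI|exact: open_iter].
- by move=> w mw; apply/O'E => j _; apply: mO; elim: j => //= j; exact: pm.
- by move=> z' z'F; apply: FS; rewrite inE z'F orbT.
have Sn : S (iter n phi z).
  by have := FS z (mem_head _ _); elim: (n) => //= k h /h; exact: pS.
have [j jJ Oj] := JP _ Sn; exists (j + n)%N; first by rewrite (leq_trans Nn) ?leq_addl.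
move=> z'; rewrite inE iterD => /predU1P[->//|z'F].
by have /O'E := nO' _ z'F; exact.
Qed.

(** Each [B i] imposes conditions on finitely many points and is nonempty by [simultaneous_hitting];
    the ultrafilter extends the filter they generate and so handles uncountably many points at
    once. *)
Lemma recurrent_ultrafilter (S m : set Omega) : closed S ->
  (forall w, S w -> S (phi w)) -> (forall w, m w -> m (phi w)) -> m !=set0 ->
  (forall z, S z -> m `<=` orbit_closure phi z) ->
  exists U : set_system nat, [/\ UltraFilter U,
    forall N, \forall n \near U, (N <= n)%N &
    forall O z, open O -> m `<=` O -> S z -> \forall n \near U, O (iter n phi z)].
Proof.
move=> cS pS pm m0 mS.
pose I := [set i : seq Omega * set Omega * nat |
  [/\ open i.1.2, m `<=` i.1.2 & forall z, z \in i.1.1 -> S z]].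
pose B (i : seq Omega * set Omega * nat) :=
  [set n | (i.2 <= n)%N /\ forall z, z \in i.1.1 -> i.1.2 (iter n phi z)].
have PF : ProperFilter (filter_from I B).
  apply: filter_from_proper; last first.
    move=> [[F O] N] [oO mO FS].
    by have [n Nn nO] := simultaneous_hitting N cS pS pm m0 mS oO mO FS; exists n.
  apply: filter_from_filter.
    by exists ([::], setT, 0%N); split=> //=; exact: openT.
  move=> [[F1 O1] N1] [[F2 O2] N2] [/= oO1 mO1 FS1] [/= oO2 mO2 FS2].
  exists (F1 ++ F2, O1 `&` O2, maxn N1 N2).
    split=> /=; [exact: openI|by move=> w mw; split; [exact: mO1|exact: mO2]|].
    by move=> z; rewrite mem_cat => /orP[/FS1|/FS2].
  move=> n /= []; rewrite geq_max => /andP[n1 n2] h; split; split=> // z zF.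
    by have [] := h z _; rewrite ?mem_cat ?zF.
  by have [] := h z _; rewrite ?mem_cat ?zF ?orbT.
have [U [UU sU]] := ultraFilterLemma PF.
exists U; split=> // [N|O z oO mO Sz].
  apply: sU; exists ([::], setT, N); first by split=> //=; exact: openT.
  by move=> n [].
apply: sU; exists ([:: z], O, 0%N).
  by split=> //= z'; rewrite inE => /eqP ->.
by move=> n [_ /(_ z)] /=; apply; rewrite mem_head.
Qed.

Definition orbit_no_independent :=
  forall (x : Omega -> R), continuous x -> forall a b, a < b ->
    no_independent (fun n w => x (iter n phi w)) a b.

Hypothesis NI : orbit_no_independent.

(** The sets where [x < c] are neighborhoods of [m], so along a recurrent ultrafilter the iterates
    of [x] fall below every positive level at each point of [S], and [ultra_cvg_measure] applies.
    The applications then undo the iterate by invariance. *)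
Lemma recurrent_small (mu : {measure set (borel Omega) -> \bar R}) (S m : set Omega)
    (x : Omega -> R) r e :
  (mu setT < +oo)%E -> mu (~` S) = 0%E -> closed S ->
  (forall w, S w -> S (phi w)) -> (forall w, m w -> m (phi w)) -> m !=set0 ->
  (forall z, S z -> m `<=` orbit_closure phi z) ->
  continuous x -> (forall w, m w -> x w = 0) -> 0 < r -> 0 < e ->
  exists n, rmeas mu [set w | r < x (iter n phi w)] < e.
Proof.
move=> mufin mS cS pS pm m0 mz cx x0 r0 e0.
have [U [UU Utail UO]] := recurrent_ultrafilter cS pS pm m0 mz.
have UP : ProperFilter U by exact: ultra_proper.
have mf n : measurable_fun setT ((fun w => x (iter n phi w)) : borel Omega -> R).
  by apply: measurable_continuous; exact: comp_iter_continuous.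
have mesS : measurable (S : set (borel Omega)).
  by rewrite -[S]setCK; apply: measurableC; apply: sub_sigma_algebra; exact: closed_openC.
suff /filter_ex[n] : \forall n \near U, rmeas mu [set w | r < x (iter n phi w)] < e.
  by exists n.
apply: (@ultra_cvg_measure _ _ _ mu mufin _ mf U UU Utail S) => //.
  by move=> a b ab; exact: NI.
move=> z c Sz c0; apply: (UO [set w | x w < c]) => //.
  by apply: (@open_comp _ _ x [set y | y < c]); [move=> w _; exact: cx|exact: open_lt].
by move=> w /x0; rewrite /= => ->.
Qed.

End semicascade.

(** * Supports of ergodic measures *)

Section minimal_sets.
Context {R : realType} {Omega : pmetricType R}.
Variable phi : Omega -> Omega.
Hypothesis cphi : continuous phi.

Lemma minimal_setP m : minimal_set phi m ->
  [/\ m !=set0, closed m, forall w, m w -> m (phi w) &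
     forall z, m z -> m = orbit_closure phi z].
Proof.
move=> [[m0 cm pm] mmin]; have pm' w : m w -> m (phi w) by move=> mw; apply: pm; exists w.
split=> // z mz; apply/esym/mmin; last exact: orbit_closure_sub.
split; [by exists z; exact: (@orbit_closure_iter _ _ phi z 0%N)|exact: closed_closure|].
by move=> _ [w zw <-]; exact: orbit_closure_invariant.
Qed.

Hypothesis unique_minimal : forall w : Omega,
  exists! m : set Omega, minimal_set phi m /\ m `<=` orbit_closure phi w.

(** The minimal set in the orbit closure of [z] also lies in that of [w], where [m] is the only
    one. *)
Lemma unique_minimal_sub w m z : minimal_set phi m -> m `<=` orbit_closure phi w ->
  orbit_closure phi w z -> m `<=` orbit_closure phi z.
Proof.
move=> mm mw wz; have [m' [[mm' m'z] _]] := unique_minimal z.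
have [m0 [_ uni]] := unique_minimal w.
rewrite -(uni m)// (uni m')//; split=> //; apply: (subset_trans m'z).
apply: orbit_closure_sub => //; first exact: closed_closure.
exact: orbit_closure_invariant.
Qed.

End minimal_sets.

Lemma countable_base (R : realType) (Omega : pmetricType R) :
  compact [set: Omega] -> exists G : nat -> set Omega, (forall n, open (G n)) /\
    forall w (V : set Omega), nbhs w V -> exists2 n, G n w & G n `<=` V.
Proof.
move=> /compact_second_countable[B /countable_injP[f finj] [oB bB]].
have [G GP] : exists G : nat -> set Omega, forall n, open (G n) /\
    forall V, B V -> f V = n -> G n = V.
  suff /choice[G GP] : forall n, exists G, open G /\ forall V, B V -> f V = n -> G = V.
    by exists G.
  move=> n; have [[V [BV <-]]|noV] := pselect (exists V, B V /\ f V = n).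
    by exists V; split=> [|V' BV' ff]; [exact: oB|apply: finj; rewrite ?inE].
  by exists setT; split=> [|V BV fV]; [exact: openT|case: noV; exists V].
exists G; split=> [n|w V /bB[V' [BV' V'w] V'V]]; first by have [] := GP n.
by exists (f V'); have [_ GE] := GP (f V'); rewrite (GE V').
Qed.

Section ergodic_support.
Context {R : realType} {Omega : pmetricType R}.
Hypothesis cO : compact [set: Omega].
Variable phi : Omega -> Omega.
Hypothesis cphi : continuous phi.
Hypothesis NI : orbit_no_independent (R := R) phi.
Hypothesis unique_minimal : forall w : Omega,
  exists! m : set Omega, minimal_set phi m /\ m `<=` orbit_closure phi w.
Variable la : probability (borel Omega) R.
Hypothesis ergodic : ergodic_measure phi la.
Local Notation S := (measure_support la).

Let borel_open (V : set Omega) : open V -> measurable (V : set (borel Omega)).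
Proof. exact: sub_sigma_algebra. Qed.

Let la_fin : (la setT < +oo)%E.
Proof. by rewrite probability_setT ltry. Qed.

Let measurable_iter n (V : set (borel Omega)) :
  measurable V -> measurable (iter n phi @^-1` V : set (borel Omega)).
Proof.
have mphi : measurable_fun setT (phi : borel Omega -> borel Omega).
  apply: (@measurability _ _ (borel Omega) (borel Omega) setT phi (@open Omega)) => //.
  move=> _ [V' oV' <-]; rewrite setTI; apply: borel_open.
  by apply: open_comp => // w _; exact: cphi.
elim: n V => //= n IH V mV; rewrite -[X in measurable X]/(iter n phi @^-1` (phi @^-1` V)).
by apply: IH; rewrite -[X in measurable X]setTI; exact: mphi.
Qed.

Let la_iter n (V : set (borel Omega)) : measurable V -> la (iter n phi @^-1` V) = la V.
Proof.
elim: n V => //= n IH V mV.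
rewrite -[X in la X]/(iter n phi @^-1` (phi @^-1` V)) IH; first exact: ergodic.1.
exact: (measurable_iter 1).
Qed.

Let supportN U : open U -> la U = 0%E -> forall w, U w -> ~ S w.
Proof. by move=> oU U0 w Uw /(_ U oU Uw); rewrite U0 ltxx. Qed.

Let support_closed : closed S.
Proof.
move=> w wS U oU Uw; have [z [Sz Uz]] := wS U (open_nbhs_nbhs (conj oU Uw)).
exact: Sz.
Qed.

Let supportC_null : la (~` S) = 0%E.
Proof.
have [G [oG bG]] := countable_base cO.
apply: (@subset_measure0 _ _ _ la _ (\bigcup_(n in [set n | la (G n) = 0%E]) G n)).
- by apply: borel_open; exact: closed_openC.
- by apply: bigcup_measurable => n _; exact: borel_open.
- move=> w; rewrite /= /measure_support /= -existsNE => -[U].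
  rewrite !not_implyE => -[oU [Uw /negP]]; rewrite -leNgt measure_le0 => /eqP U0.
  have [n Gw GU] := bG w U (open_nbhs_nbhs (conj oU Uw)).
  exists n => //=; exact: (subset_measure0 (borel_open (oG n)) (borel_open oU) GU U0).
- apply: (@null_bigcup _ _ _ la la_fin) => n /= Gn; first exact: borel_open.
  exact: (congr1 fine Gn).
Qed.

Let support_invariant w : S w -> S (phi w).
Proof.
move=> Sw U oU Uw; rewrite -(ergodic.1 U); last exact: borel_open.
by apply: Sw => //; apply: open_comp => // z _; exact: cphi.
Qed.

(** [ergodic_measure] speaks of exactly invariant sets, and the upper limit of the preimages of [V]
    is one. It is not null, because every tail union contains a preimage of [V], of measure
    [la V]. *)
Let visits_often (V : set Omega) : open V -> la V <> 0%E ->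
  la (~` lim_sup_set (fun n => iter n phi @^-1` V)) = 0%E.
Proof.
move=> oV V0; set F := fun n => iter n phi @^-1` V.
have mF n : measurable (F n : set (borel Omega)).
  by apply: measurable_iter; exact: borel_open.
have mU n : measurable (\bigcup_(k >= n) F k : set (borel Omega)).
  by apply: bigcup_measurable.
have mL : measurable (lim_sup_set F : set (borel Omega)).
  exact: bigcapT_measurable.
have inv : phi @^-1` lim_sup_set F = lim_sup_set F.
  apply/seteqP; split=> w h n _.
    have [k /= nk Fk] := h n I; exists k.+1; first exact: leqW.
    by have : V (iter k phi (phi w)) := Fk; rewrite -iterSr.
  have [[//|k] /= nk Fk] := h n.+1 I; exists k => //.
  by have : V (iter k.+1 phi w) := Fk; rewrite iterSr.
have [L0|L1] := ergodic.2 _ mL inv; last first.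
  by rewrite probability_setC// L1 subee.
have V0' : 0 < rmeas la V.
  rewrite lt_neqAle rmeas_ge0 andbT eq_sym; apply/eqP => V0'; apply: V0.
  by rewrite (rmeasE la_fin) ?V0'//; exact: borel_open.
have [|N NP] := rmeas_decreasing la_fin V0' mU _ L0.
  by move=> n w [k /= nk Fk]; exists k => //=; exact: ltnW.
have := NP N (leqnn _); rewrite ltNge => /negP[].
have <- : rmeas la (F N) = rmeas la V := congr1 fine (la_iter N (borel_open oV)).
by apply: (le_rmeas la_fin) => // w Vw; exists N => /=.
Qed.

(** Basic open sets meeting the support are non-null, so almost every point enters each of them; the
    base being countable, some point enters them all. *)
Let dense_orbit : exists2 w, S w & S `<=` orbit_closure phi w.
Proof.
have [G [oG bG]] := countable_base cO.
pose E n := ~` lim_sup_set (fun k => iter k phi @^-1` (G n)).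
pose J := [set n | la (G n) <> 0%E].
have mE n : measurable (E n : set (borel Omega)).
  apply: measurableC; apply: bigcapT_measurable => k; apply: bigcup_measurable => i _.
  by apply: measurable_iter; exact: borel_open.
have N0 : la (~` S `|` \bigcup_(n in J) E n) = 0%E.
  apply: null_set_setU => //.
  - by apply: borel_open; exact: closed_openC.
  - by apply: bigcup_measurable => n _.
  - apply: (@null_bigcup _ _ _ la la_fin) => n // In.
    exact: (congr1 fine (visits_often (oG n) In)).
have [w Nw] : exists w, ~ (~` S `|` \bigcup_(n in J) E n) w.
  apply: contrapT => noW; have TE : setT = ~` S `|` \bigcup_(n in J) E n.
    by apply/seteqP; split=> // w _; apply: contrapT => ?; apply: noW; exists w.
  have : la setT = 0%E by rewrite TE; exact: N0.
  by rewrite probability_setT => /eqP; rewrite onee_eq0.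
have Sw : S w by apply: contrapT => ?; apply: Nw; left.
exists w => // z Sz B /bG[n Gz GB].
have In : J n by move=> G0; exact: (supportN (oG n) G0 Gz).
have : lim_sup_set (fun k => iter k phi @^-1` (G n)) w.
  by apply: contrapT => ?; apply: Nw; right; exists n.
move=> /(_ 0%N I)[k _ Gk].
by exists (iter k phi w); split; [exists k|exact: GB].
Qed.

(** The support is an orbit closure with minimal set [m]. A point of it outside [m] would have a
    neighborhood [V], of positive measure and away from [m]; by [recurrent_small] some preimage of
    [V] would have smaller measure than [V], against invariance. *)
Lemma ergodic_support_minimal : minimal_set phi S.
Proof.
have [w Sw Sdense] := dense_orbit.
have SE : orbit_closure phi w `<=` S by exact: orbit_closure_sub.
have [m [[mm mw] _]] := unique_minimal w.
have [m0 cm pm _] := minimal_setP cphi mm.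
have mz z : S z -> m `<=` orbit_closure phi z.
  by move=> /Sdense; exact: unique_minimal_sub.
have [d [cd d0 dP]] := closed_zero_set cm.
suff -> : S = m by [].
apply/seteqP; split; last by apply: subset_trans SE.
move=> z Sz; apply: contrapT => mNz.
have dz : 0 < d z by rewrite lt_neqAle d0 andbT eq_sym; apply/eqP => /dP.
pose V := [set u : Omega | d z / 2 < d u].
have oV : open V.
  by apply: (@open_comp _ _ d [set y | d z / 2 < y]); [move=> u _; exact: cd|exact: open_gt].
have Vz : V z by rewrite /V /=; lra.
have := Sz V oV Vz; rewrite (rmeasE la_fin); last exact: borel_open.
rewrite lte_fin => V0; have dz2 : 0 < d z / 2 by lra.
have [|n] := recurrent_small cO cphi NI la_fin supportC_null support_closed
  support_invariant pm m0 mz cd _ dz2 V0.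
  by move=> u /dP.
have <- : rmeas la (iter n phi @^-1` V) = rmeas la V :=
  congr1 fine (la_iter n (borel_open oV)).
by rewrite ltxx.
Qed.

End ergodic_support.

(** * Invariant means *)

Lemma ultra_cvg (R : realType) (U : set_system nat) (u : nat -> R) (c : R) :
  UltraFilter U -> (forall n, `|u n| <= c) -> cvg (u n @[n --> U]).
Proof.
move=> UU uc; have UP : ProperFilter U by exact: ultra_proper.
have [|p [_ clp]] := @segment_compact R (- c) c (u @ U) _.
  by apply: nearW => n; rewrite /= in_itv/= -ler_norml.
apply/cvg_ex; exists p => B Bp.
have [//|UB] := in_ultra_setVsetC (u @^-1` B) UU.
by have [t [nBt Bt]] := clp (~` B) B UB Bp.
Qed.

Lemma free_ultrafilter (F : set_system nat) : ProperFilter F ->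
  (forall N, \forall n \near F, (N <= n)%N) ->
  exists U, [/\ UltraFilter U, forall N, \forall n \near U, (N <= n)%N & F `<=` U].
Proof.
move=> PF Ftail; have [U [UU FU]] := ultraFilterLemma PF.
by exists U; split=> // N; apply: FU; exact: Ftail.
Qed.

Section means.
Context {R : realType} {Omega : pmetricType R}.
Hypothesis cO : compact [set: Omega].

Definition mean (E : (Omega -> R) -> R) : Prop :=
  [/\ forall f g : Omega -> R, continuous f -> continuous g ->
        E (fun w => f w + g w) = E f + E g,
      forall a (f : Omega -> R), continuous f -> E (fun w => a * f w) = a * E f,
      forall f : Omega -> R, continuous f -> (forall w, 0 <= f w) -> 0 <= E f &
      E (fun=> 1) = 1].

Lemma mean_add E (f g : Omega -> R) : mean E -> continuous f -> continuous g ->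
  E (fun w => f w + g w) = E f + E g.
Proof. by case=> ED _ _ _; exact: ED. Qed.

Lemma mean_scale E a (f : Omega -> R) : mean E -> continuous f ->
  E (fun w => a * f w) = a * E f.
Proof. by case=> _ EZ _ _; exact: EZ. Qed.

Lemma mean_cst E a : mean E -> E (fun=> a) = a.
Proof.
move=> [_ EZ _ E1]; rewrite -[RHS]mulr1 -E1 -EZ.
  by congr E; apply/funext => w; rewrite mulr1.
by move=> w; exact: cvg_cst.
Qed.

Lemma mean_opp E (f : Omega -> R) : mean E -> continuous f ->
  E (fun w => - f w) = - E f.
Proof.
move=> mE cf; rewrite -mulN1r -(mean_scale _ mE)//.
by congr E; apply/funext => w; rewrite mulN1r.
Qed.

Lemma mean_sub E (f g : Omega -> R) : mean E -> continuous f -> continuous g ->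
  E (fun w => f w - g w) = E f - E g.
Proof.
move=> mE cf cg; rewrite (mean_add mE)// ?(mean_opp mE)// => w.
by apply: cvgN; exact: cg.
Qed.

Lemma le_mean E (f g : Omega -> R) : mean E -> continuous f -> continuous g ->
  (forall w, f w <= g w) -> E f <= E g.
Proof.
move=> mE cf cg fg; rewrite -subr_ge0 -(mean_sub mE)//.
case: mE => _ _ E0 _; apply: E0 => w; last by rewrite subr_ge0.
by apply: cvgB; [exact: cg|exact: cf].
Qed.

Lemma mean_norm_le E (f : Omega -> R) (c : R) : mean E -> continuous f ->
  (forall w, `|f w| <= c) -> `|E f| <= c.
Proof.
move=> mE cf fc; have cc : continuous (fun _ : Omega => c) by move=> w; exact: cvg_cst.
have cc' : continuous (fun _ : Omega => - c) by move=> w; exact: cvg_cst.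
rewrite ler_norml; apply/andP; split.
  rewrite -[leLHS](mean_cst (- c) mE); apply: le_mean => // w.
  by have := fc w; rewrite ler_norml => /andP[].
rewrite -[leRHS](mean_cst c mE); apply: le_mean => // w.
by have := fc w; rewrite ler_norml => /andP[].
Qed.

Lemma mean_bounded E : mean E -> bounded_functional E 1.
Proof.
move=> mE; have [ED EZ _ _] := mE; split=> // f c cf fc.
by rewrite mul1r; exact: mean_norm_le.
Qed.

Lemma mean_sum E (I : Type) (s : seq I) (F : I -> Omega -> R) : mean E ->
  (forall i, continuous (F i)) ->
  E (fun w => \sum_(i <- s) F i w) = \sum_(i <- s) E (F i).
Proof.
move=> mE cF; elim: s => [|i s IH].
  by rewrite big_nil -[RHS](mean_cst 0 mE); congr E; apply/funext => w; rewrite big_nil.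
rewrite big_cons -IH -(mean_add mE)//; last exact: continuous_bigsum.
by congr E; apply/funext => w; rewrite big_cons.
Qed.

Lemma weighted_mean (I : finType) (a : I -> R) (t : I -> Omega) :
  (forall i, 0 <= a i) -> \sum_i a i = 1 -> mean (fun f => \sum_i a i * f (t i)).
Proof.
move=> a0 a1; split=> [f g _ _|b f _|f _ f0|].
- by rewrite -big_split; apply: eq_bigr => i _; rewrite mulrDr.
- by rewrite mulr_sumr; apply: eq_bigr => i _; rewrite mulrCA.
- by apply: sumr_ge0 => i _; rewrite mulr_ge0.
- by under eq_bigr do rewrite mulr1.
Qed.

(** Weak-star compactness of the set of means. *)
Lemma mean_ultralimit (E : nat -> (Omega -> R) -> R) (U : set_system nat) :
  UltraFilter U -> (forall n, mean (E n)) ->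
  exists L, mean L /\ forall f : Omega -> R, continuous f -> E n f @[n --> U] --> L f.
Proof.
move=> UU mE; have UP : ProperFilter U by exact: ultra_proper.
have cvE (f : Omega -> R) : continuous f ->
    E n f @[n --> U] --> lim (E n f @[n --> U]).
  move=> cf; have [c _ fc] := continuous_bounded cO cf.
  by apply: (@ultra_cvg _ _ _ c) => // n; exact: mean_norm_le.
exists (fun f => lim (E n f @[n --> U])); split=> //; split=> [f g cf cg|a f cf|f cf f0|].
- apply: cvg_lim => //; under eq_fun do rewrite (mean_add (mE _))//.
  by apply: cvgD; exact: cvE.
- apply: cvg_lim => //; under eq_fun do rewrite (mean_scale _ (mE _))//.
  by apply: cvgMr; exact: cvE.
- apply: limr_ge; first by apply: cvE.
  by apply: nearW => n; have [_ _ + _] := mE n; apply.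
- by apply: cvg_lim => //; under eq_fun do rewrite (mean_cst 1 (mE _)); exact: cvg_cst.
Qed.

Variable phi : Omega -> Omega.
Hypothesis cphi : continuous phi.
Hypothesis NI : orbit_no_independent (R := R) phi.

(** Total boundedness of the translates of [x] in the L^1 seminorm of [E], obtained from
    [measure_net] for the dominating measure. *)
Lemma mean_net E (x : Omega -> R) e : mean E -> continuous x -> 0 < e ->
  exists s : seq nat, forall n, exists2 k, k \in s &
    E (fun w => `|x (iter n phi w) - x (iter k phi w)|) <= e.
Proof.
move=> mE cx e0; have [c c0 xc] := continuous_bounded cO cx.
have [mu [mufin _ mudom]] := dominating_measure cO (mean_bounded mE).
(* Solves [e' + 2 * c * e' = e], where [2 * c] bounds the difference of two translates. *)
pose e' := e / (1 + 2 * c); have e'0 : 0 < e' by rewrite divr_gt0//; lra.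
have mf n : measurable_fun setT ((fun w => x (iter n phi w)) : borel Omega -> R).
  by apply: measurable_continuous; exact: comp_iter_continuous.
have [||s sP] := measure_net (c := c) mufin mf e'0; [by move=> a b ab; exact: NI| |].
  by move=> n w; exact: xc.
exists s => n; have [k ks nk] := sP n; exists k => //.
have cd : continuous (fun w => `|x (iter n phi w) - x (iter k phi w)|).
  by move=> w; apply: cvg_norm; apply: cvgB; exact: comp_iter_continuous.
apply: (le_trans (ler_norm _)); apply: (le_trans (mudom _ (2 * c) e' cd _ (ltW e'0))).
  move=> w; rewrite normr_id (le_trans (ler_normB _ _))//.
  by have := xc (iter n phi w); have := xc (iter k phi w); lra.
under eq_set do rewrite normr_id.
have -> : e = e' + 2 * c * e' by rewrite /e'; field; apply/eqP; lra.
by rewrite mul1r lerD2l ler_wpM2l ?(ltW nk)//; lra.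
Qed.

Definition cesaro (x : Omega -> R) (N : nat) (w : Omega) : R :=
  N%:R^-1 * \sum_(j < N) x (iter j phi w).

Lemma cesaro_continuous (x : Omega -> R) N : continuous x -> continuous (cesaro x N).
Proof.
move=> cx w; apply: cvgMr.
by apply: (continuous_bigsum (F := fun (j : 'I_N) w => x (iter j phi w))) => j;
  exact: comp_iter_continuous.
Qed.
End means.

(** * Total boundedness of Cesaro means *)

Section cesaro_means.
Context {R : realType} {Omega : pmetricType R}.
Hypothesis cO : compact [set: Omega].
Variable phi : Omega -> Omega.
Hypothesis cphi : continuous phi.
Hypothesis NI : orbit_no_independent (R := R) phi.

(* Cesaro means are convex combinations of the totally bounded family of the
   [x (iter j phi w)], hence themselves form a totally bounded family. *)
Lemma mean_cesaro_close E (x : Omega -> R) (n : nat -> nat) e : mean E ->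
  continuous x -> 0 < e -> (forall k, (0 < n k)%N) ->
  exists k l, (k < l)%N /\
    E (fun w => `|cesaro phi x (n k) w - cesaro phi x (n l) w|) <= e.
Proof.
move=> mE cx e0 n0.
have [c c0 xc] := continuous_bounded cO cx.
have e30 : 0 < e / 3 by lra.
have [s sP] := mean_net cO cphi NI mE cx e30.
have [sig sigP] : exists sig : nat -> 'I_(size s), forall j,
    E (fun w => `|x (iter j phi w) - x (iter (nth 0%N s (sig j)) phi w)|) <= e / 3.
  suff /choice[sig sigP] : forall j, exists i : 'I_(size s),
    E (fun w => `|x (iter j phi w) - x (iter (nth 0%N s i) phi w)|) <= e / 3 by exists sig.
  move=> j; have [k ks jk] := sP j.
  have ks' : (index k s < size s)%N by rewrite index_mem.
  by exists (Ordinal ks'); rewrite /= nth_index.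
pose y (i : 'I_(size s)) w := x (iter (nth 0%N s i) phi w).
pose a k (i : 'I_(size s)) : R := (n k)%:R^-1 * \sum_(j < n k) (sig j == i)%:R.
(* The Cesaro mean with each translate replaced by its representative in the net. It lies in a
   finite-dimensional simplex, with the frequencies [a k i] as coordinates. *)
pose F k w := (n k)%:R^-1 * \sum_(j < n k) y (sig j) w.
have FE k w : F k w = \sum_i a k i * y i w.
  rewrite /F /a; under [in RHS]eq_bigr do rewrite -mulrA mulr_suml.
  rewrite -mulr_sumr exchange_big /=; congr (_ * _); apply: eq_bigr => j _.
  rewrite (bigD1 (sig j))//= eqxx mul1r big1 ?addr0// => i.
  by rewrite eq_sym => /negbTE ->; rewrite mul0r.
have a_le1 k i : `|a k i| <= 1.
  rewrite ger0_norm; last first.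
    by rewrite mulr_ge0 ?invr_ge0//; apply: sumr_ge0.
  rewrite ler_pdivrMl ?ltr0n// mulr1.
  have : \sum_(j < n k) ((sig j == i)%:R : R) <= \sum_(j < n k) 1.
    by apply: ler_sum => j _; rewrite lern1 leq_b1.
  by rewrite sumr_const card_ord.
have [U [UU Utail _]] := free_ultrafilter (F := \oo) _ (fun N => nbhs_infty_ge N).
have UP : ProperFilter U by exact: ultra_proper.
have cva i : cvg (a k i @[k --> U]) := ultra_cvg UU (fun k => a_le1 k i).
pose r : R := (size s)%:R; have r0 : 0 <= r by [].
(* Coordinates within [h] of their limits are within [2 * h] of each other, which moves a
   combination of [size s] functions bounded by [c] by at most [e / 3]. The [+ 1] prevents a zero
   denominator. *)
pose h := e / 3 / (2 * (r * c) + 1).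
have rc0 : 0 <= r * c by rewrite mulr_ge0.
have h0 : 0 < h by rewrite divr_gt0//; lra.
have hle : r * (2 * h * c) <= e / 3.
  have -> : r * (2 * h * c) = e / 3 * (2 * (r * c) / (2 * (r * c) + 1)).
    by rewrite /h; field; apply/eqP; lra.
  by rewrite ger_pMr// ler_pdivrMr; lra.
have near_lim : \forall k \near U, forall i, `|lim (a k i @[k --> U]) - a k i| < h.
  by apply: filter_forall => i; move/cvgrPdist_lt : (cva i); apply.
have [k kP] := filter_ex near_lim.
have near_lim' : \forall l \near U, (k.+1 <= l)%N /\
    forall i, `|lim (a k i @[k --> U]) - a l i| < h.
  by apply: filterS2 (Utail k.+1) near_lim => l; exact: conj.
have [l [kl lP]] := filter_ex near_lim'.
exists k, l; split=> //.
have cy i : continuous (y i) by exact: comp_iter_continuous.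
have cF m : continuous (F m).
  by move=> w; apply: cvgMr; apply: (continuous_bigsum (F := fun j : 'I__ => y (sig j))).
have cces m := cesaro_continuous (N := m) cphi cx.
have cdist (f g : Omega -> R) : continuous f -> continuous g ->
    continuous (fun w => `|f w - g w|).
  by move=> cf cg w; apply: cvg_norm; apply: cvgB; [exact: cf|exact: cg].
have cesF m : E (fun w => `|cesaro phi x (n m) w - F m w|) <= e / 3.
  pose D (j : 'I_(n m)) w := `|x (iter j phi w) - y (sig j) w|.
  have cD j : continuous (D j) by apply: cdist; [exact: comp_iter_continuous|exact: cy].
  have csD : continuous (fun w => \sum_j D j w) by exact: continuous_bigsum.
  apply: (@le_trans _ _ (E (fun w => (n m)%:R^-1 * \sum_j D j w))).
    apply: (le_mean mE); first exact: cdist.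
      by move=> w; apply: cvgMr; exact: csD.
    move=> w; rewrite /cesaro /F -mulrBr -sumrB normrM ger0_norm ?invr_ge0//.
    by rewrite ler_wpM2l ?invr_ge0// ler_norm_sum.
  rewrite (mean_scale _ mE)// (mean_sum _ mE)// ler_pdivrMl ?ltr0n//.
  have : \sum_(j < n m) E (D j) <= \sum_(j < n m) e / 3 by apply: ler_sum => j _; exact: sigP.
  by rewrite sumr_const card_ord mulr_natl.
have Fkl w : `|F k w - F l w| <= e / 3.
  rewrite !FE -sumrB; apply: le_trans hle.
  rewrite (le_trans (ler_norm_sum _ _ _))//.
  have -> : r * (2 * h * c) = \sum_(i < size s) 2 * h * c.
    by rewrite sumr_const card_ord -[RHS]mulr_natl.
  apply: ler_sum => i _; rewrite -mulrBl normrM ler_pM ?xc//.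
  have := kP i; have := lP i; rewrite !ltr_norml ler_norml.
  move: (lim _) => z; lra.
apply: (@le_trans _ _ (E (fun w => (`|cesaro phi x (n k) w - F k w| + e / 3) +
    `|cesaro phi x (n l) w - F l w|))).
  have ce : continuous (fun _ : Omega => e / 3) by move=> w; exact: cvg_cst.
  apply: (le_mean mE); first exact: cdist.
    move=> w; apply: cvgD; last exact: cdist.
    by apply: cvgD; [exact: cdist|exact: ce].
  move=> w; have := Fkl w.
  have := ler_distD (F k w) (cesaro phi x (n k) w) (cesaro phi x (n l) w).
  have := ler_distD (F l w) (F k w) (cesaro phi x (n l) w).
  rewrite (distrC (F l w) (cesaro phi x (n l) w)); lra.
have ce : continuous (fun _ : Omega => e / 3) by move=> w; exact: cvg_cst.
have cd1 := cdist _ _ (cces (n k)) (cF k).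
rewrite (mean_add mE); [|by move=> w; apply: cvgD; [exact: cd1|exact: ce]|exact: cdist].
rewrite (mean_add mE)// (mean_cst _ mE).
by have := cesF k; have := cesF l; lra.
Qed.

End cesaro_means.

(** Flipping coordinate [k] pairs the patterns that agree at [k] and [l] with those that differ
    there. *)
Lemma half_patterns_differ N (k l : 'I_N) : k != l ->
  (2 * \sum_(s : {ffun 'I_N -> bool}) (s k != s l) = 2 ^ N)%N.
Proof.
move=> kl; pose flip (s : {ffun 'I_N -> bool}) := [ffun i => s i (+) (i == k)].
have flipK : involutive flip.
  by move=> s; apply/ffunP => i; rewrite !ffunE addbK.
rewrite mul2n -addnn {2}(reindex_inj (inv_inj flipK)) -big_split /=.
rewrite -[in RHS](card_ord N) -card_bool -card_ffun -sum1_card.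
apply: eq_bigr => s _; rewrite !ffunE eqxx (eq_sym l) (negbTE kl) addbF.
by case: (s k); case: (s l).
Qed.

(** * Uniqueness of the invariant mean *)

Section unique_ergodicity.
Context {R : realType} {Omega : pmetricType R}.
Hypothesis cO : compact [set: Omega].
Variable phi : Omega -> Omega.
Hypothesis cphi : continuous phi.
Hypothesis NI : orbit_no_independent (R := R) phi.

(* On an independent sequence of Cesaro means, a coin-tossing measure keeps any two
   terms at a fixed distance in mean, against [mean_cesaro_close]. *)
Lemma cesaro_no_independent (x : Omega -> R) a b : continuous x -> a < b ->
  no_independent (cesaro phi x) a b.
Proof.
move=> cx ab [n [n0 _ ind]].
have [t tP] : exists t : forall N, {ffun 'I_N -> bool} -> Omega,
    forall N (s : {ffun 'I_N -> bool}) (k : 'I_N),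
    side (cesaro phi x (n k)) a b (s k) (t N s).
  have H N (s : {ffun 'I_N -> bool}) : exists t, forall k : 'I_N,
      side (cesaro phi x (n k)) a b (s k) t.
    have [t tP] := ind (fun k => if insub k is Some i then s i else false) N.
    by exists t => k; have := tP k (ltn_ord k); rewrite valK.
  by exists (fun N s => projT1 (cid (H N s))) => N s; exact: (projT2 (cid (H N s))).
pose E N (f : Omega -> R) := \sum_(s : {ffun 'I_N -> bool}) (2 ^+ N)^-1 * f (t N s).
have mE N : mean (E N).
  apply: weighted_mean => [s|]; first by rewrite invr_ge0 exprn_ge0.
  rewrite sumr_const card_ffun card_bool card_ord -[LHS]mulr_natl natrX divff//.
have [U [UU Utail _]] := free_ultrafilter (F := \oo) _ (fun N => nbhs_infty_ge N).
have UP : ProperFilter U by exact: ultra_proper.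
(* [mean_cesaro_close] chooses [k] and [l] according to the mean, so one mean has to govern all
   coordinates, while [E N] governs only those below [N]. *)
have [L [mL EL]] := mean_ultralimit cO UU mE.
(* Half of the patterns differ at [k] and [l], each contributing at least [b - a]: the mean distance
   is at least twice this number. *)
have e0 : 0 < (b - a) / 4 by lra.
have [k [l [kl Lkl]]] := mean_cesaro_close cO cphi NI mL cx e0 n0.
suff : (b - a) / 2 <= L (fun w => `|cesaro phi x (n k) w - cesaro phi x (n l) w|) by lra.
have cces m := cesaro_continuous (N := m) cphi cx.
have cd : continuous (fun w => `|cesaro phi x (n k) w - cesaro phi x (n l) w|).
  by move=> w; apply: cvg_norm; apply: cvgB; exact: cces.
have /cvg_lim <- // := EL _ cd.
apply: limr_ge; first by apply: cvgP (EL _ cd).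
apply: filterS (Utail l.+1) => N lN; rewrite /E -mulr_sumr.
rewrite ler_pdivlMl ?exprn_gt0//.
have kN : (k < N)%N by exact: ltn_trans lN.
pose k' := Ordinal kN; pose l' : 'I_N := Ordinal lN.
have kl' : k' != l' by rewrite -val_eqE /= neq_ltn kl.
have -> : 2 ^+ N * ((b - a) / 2) =
    \sum_(s : {ffun 'I_N -> bool}) (s k' != s l')%:R * (b - a).
  have /(congr1 (fun m => m%:R : R)) := half_patterns_differ kl'.
  rewrite natrX => <-; rewrite natrM natr_sum -mulr_suml.
  by move: (\sum_i _) => z; lra.
apply: ler_sum => s _; have := tP N s k'; have := tP N s l'; rewrite /side /=.
case: (s k'); case: (s l') => /= h1 h2; rewrite ?mul0r// mul1r.
- by rewrite (le_trans _ (ler_norm _))//; lra.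
- by rewrite distrC (le_trans _ (ler_norm _))//; lra.
Qed.

Variables (S m : set Omega).
Hypotheses (cS : closed S) (pS : forall w, S w -> S (phi w)).
Hypothesis mm : minimal_set phi m.
Hypothesis mz : forall z, S z -> m `<=` orbit_closure phi z.

Definition invariant_mean (L : (Omega -> R) -> R) : Prop :=
  [/\ mean L,
    forall f : Omega -> R, continuous f -> L (fun w => f (phi w)) = L f &
    forall f : Omega -> R, continuous f -> (forall w, S w -> f w = 0) -> L f = 0].

Lemma invariant_mean_iter L (f : Omega -> R) n : invariant_mean L -> continuous f ->
  L (fun w => f (iter n phi w)) = L f.
Proof.
move=> [_ Linv _] cf; elim: n => // n IH; rewrite -[RHS]IH -[RHS]Linv; last first.
  exact: comp_iter_continuous.
by congr L; apply/funext => w; rewrite iterSr.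
Qed.

(** Invariance of [L] replaces [x] by an iterate that is small in measure, by [recurrent_small] for
    the measure dominating [L]. *)
Lemma invariant_mean_eq0 L (x : Omega -> R) : invariant_mean L -> continuous x ->
  (forall w, 0 <= x w) -> (forall w, m w -> x w = 0) -> L x = 0.
Proof.
move=> iL cx x0 xm; have [mL _ L0] := iL.
have [c c0 xc] := continuous_bounded cO cx.
have [mu [mufin mu0 mudom]] := dominating_measure cO (mean_bounded mL).
have muS : mu (~` S) = 0%E.
  apply: mu0; first exact: closed_openC.
  by move=> f cf f0; apply: L0 => // w Sw; apply: f0 => /(_ Sw).
have [m0 cm pm _] := minimal_setP cphi mm.
apply/eqP; rewrite -normr_le0; apply/ler_addgt0Pr => e e0; rewrite add0r.
pose r := e / (1 + c); have r0 : 0 < r by rewrite divr_gt0//; lra.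
have [n nr] := recurrent_small cO cphi NI mufin muS cS pS pm m0 mz cx xm r0 r0.
have cxn := comp_iter_continuous cphi (n := n) cx.
rewrite -(invariant_mean_iter n iL cx).
apply: (le_trans (mudom _ c r cxn (fun w => xc _) (ltW r0))).
under eq_set do rewrite ger0_norm//.
have -> : e = r + c * r by rewrite /r; field; apply/eqP; lra.
by rewrite mul1r lerD2l ler_wpM2l// ltW.
Qed.

Lemma invariant_mean_ge L (x : Omega -> R) c : invariant_mean L -> continuous x ->
  (forall w, m w -> c <= x w) -> c <= L x.
Proof.
move=> iL cx xm; have [mL _ _] := iL.
have cc : continuous (fun _ : Omega => c) by move=> w; exact: cvg_cst.
have cd : continuous (fun w => c - x w).
  by move=> w; apply: cvgB; [exact: cc|exact: cx].
have cn : continuous (fun w => `|c - x w|) by move=> w; apply: cvg_norm; exact: cd.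
(* Twice the positive part of [c - x w], which vanishes on [m]. *)
have cs : continuous (fun w => `|c - x w| + (c - x w)).
  by move=> w; apply: cvgD; [exact: cn|exact: cd].
have : L (fun w => `|c - x w| + (c - x w)) = 0.
  apply: invariant_mean_eq0 => // [w|w /xm cxw].
    by have := ler_norm (- (c - x w)); rewrite normrN; lra.
  by rewrite ler0_norm; lra.
rewrite (mean_add mL)// => h.
have : 0 <= L (fun w => `|c - x w|) by have [_ _ + _] := mL; apply.
have : L (fun w => c - x w) = c - L x by rewrite (mean_sub mL)// (mean_cst c mL).
by lra.
Qed.

(** A single step changes only the two end terms of the sum. *)
Lemma cesaro_shift (x : Omega -> R) c N j w : (forall w, `|x w| <= c) ->
  `|cesaro phi x N (iter j phi w) - cesaro phi x N w| <= N%:R^-1 * (j%:R * (2 * c)).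
Proof.
move=> xc; elim: j => [|j IH]; first by rewrite subrr normr0 mul0r mulr0.
set v := iter j phi w in IH *.
have step : `|cesaro phi x N (phi v) - cesaro phi x N v| <= N%:R^-1 * (2 * c).
  rewrite /cesaro -mulrBr normrM ger0_norm ?invr_ge0// ler_wpM2l ?invr_ge0//.
  have -> : \sum_(i < N) x (iter i phi (phi v)) = \sum_(i < N) x (iter i.+1 phi v).
    by apply: eq_bigr => i _; rewrite iterSr.
  rewrite -sumrB -(big_mkord xpredT (fun i => x (iter i.+1 phi v) - x (iter i phi v))).
  rewrite telescope_sumr//= (le_trans (ler_normB _ _))//.
  by have := xc (iter N phi v); have := xc v; lra.
rewrite iterS -/v -natr1 mulrDl mul1r mulrDr.
rewrite (le_trans (ler_distD (cesaro phi x N v) _ _))// addrC lerD//.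
Qed.

(** By minimality all orbits in [m] enter [V] within a bounded time [J]. If the Cesaro mean were at
    least [c] on the part of [V] in [m], it would be at least [c - 2 d J / N] on [m], where |x| <=
    d; so would its value under [L], which is [L x]. For large [N] this is false. *)
Lemma cesaro_below L (x : Omega -> R) c (V : set Omega) : invariant_mean L ->
  continuous x -> L x < c -> open V -> V `&` m !=set0 ->
  \forall N \near \oo, exists z, [/\ V z, m z & cesaro phi x N z < c].
Proof.
move=> iL cx Lxc oV [v [Vv mv]]; have [mL _ _] := iL.
have [d d0 xd] := continuous_bounded cO cx.
have [m0 cm pm mE] := minimal_setP cphi mm.
have [J JP] : exists J, forall z, m z -> exists2 j, (j <= J)%N & V (iter j phi z).
  apply: uniform_hitting => // z mz'.
  by apply: (@orbit_closure_hits _ _ phi z v) => //; rewrite -mE.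
have [N0 _ N0P] := nbhs_infty_gtr (J%:R * (2 * d) / (c - L x)).
exists (maxn N0 1) => // N /=; rewrite geq_max => /andP[NN0 N1].
have Npos : 0 < N%:R :> R by rewrite ltr0n.
have := N0P N NN0; rewrite /= ltr_pdivrMr ?subr_gt0// => Nbig.
apply: contrapT => noz.
have big z : V z -> m z -> c <= cesaro phi x N z.
  by move=> Vz mz'; rewrite leNgt; apply/negP => h; apply: noz; exists z.
have Lces : L (cesaro phi x N) = L x.
  have cs : continuous (fun w => \sum_(j < N) x (iter j phi w)).
    apply: (continuous_bigsum (F := fun (j : 'I_N) w => x (iter j phi w))) => j.
    exact: comp_iter_continuous.
  rewrite /cesaro (mean_scale _ mL)//.
  rewrite (mean_sum _ (F := fun (j : 'I_N) w => x (iter j phi w)) mL); last first.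
    by move=> j; exact: comp_iter_continuous.
  under eq_bigr do rewrite (invariant_mean_iter _ iL cx).
  by rewrite sumr_const card_ord -(mulr_natl (L x)) mulKf// lt0r_neq0.
have : c - N%:R^-1 * (J%:R * (2 * d)) <= L (cesaro phi x N).
  apply: invariant_mean_ge => //; first exact: cesaro_continuous.
  move=> w mw; have [j jJ Vj] := JP w mw.
  have mj : m (iter j phi w) by elim: (j) => //= i; exact: pm.
  have := big _ Vj mj; have := cesaro_shift N j w xd.
  have : N%:R^-1 * (j%:R * (2 * d)) <= N%:R^-1 * (J%:R * (2 * d)).
    by rewrite ler_wpM2l ?invr_ge0// ler_wpM2r ?ler_nat// mulr_ge0.
  by rewrite ler_norml; lra.
rewrite Lces; suff : N%:R^-1 * (J%:R * (2 * d)) < c - L x by lra.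
by rewrite ltr_pdivrMl.
Qed.

Lemma cesaroN (x : Omega -> R) N w : cesaro phi (fun w => - x w) N w = - cesaro phi x N w.
Proof. by rewrite /cesaro sumrN mulrN. Qed.

(* If [L1 x < a < b < L2 x], long Cesaro means of [x] take values below [a] and above [b]
   on every open set meeting [m]. *)
Lemma invariant_mean_unique L1 L2 (x : Omega -> R) :
  invariant_mean L1 -> invariant_mean L2 -> continuous x -> L1 x = L2 x.
Proof.
suff H L L' : invariant_mean L -> invariant_mean L' -> continuous x -> L' x <= L x.
  by move=> i1 i2 cx; apply/eqP; rewrite eq_le !H.
move=> iL iL' cx; rewrite leNgt; apply/negP => LL'.
pose a := L x + (L' x - L x) / 3; pose b := L' x - (L' x - L x) / 3.
have ab : a < b by rewrite /a /b; lra.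
apply: (cesaro_no_independent cx ab).
pose Big (V : set Omega) := open V /\ V `&` m !=set0.
have [[m0 _ _] _] := mm.
have cces N := cesaro_continuous (N := N) cphi cx.
have PF : ProperFilter (\oo : set_system nat) := _.
apply: (@independent_subsequence R Omega (cesaro phi x) a b \oo Big) => //.
- exact: nbhs_infty_ge.
- by split; [exact: openT|rewrite setTI].
- by move=> V [_ [z [Vz _]]]; exists z.
move=> V [] [oV Vm].
  (* The upper side for [x] at [b] is the lower side for [- x] at [- b]. *)
  have cx' : continuous (fun w => - x w) by move=> w; apply: cvgN; exact: cx.
  have [mL' _ _] := iL'.
  have Lb : L' (fun w => - x w) < - b by rewrite (mean_opp mL')// /b; lra.
  apply: filterS (cesaro_below iL' cx' Lb oV Vm) => N [z [Vz mz']].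
  rewrite cesaroN ltrN2 => bz; split; last by exists z.
  apply: openI => //; apply: (@open_comp _ _ (cesaro phi x N) [set y | b < y]).
    by move=> w _; exact: cces.
  exact: open_gt.
have La : L x < a by rewrite /a; lra.
apply: filterS (cesaro_below iL cx La oV Vm) => N [z [Vz mz' za]].
split; last by exists z.
apply: openI => //; apply: (@open_comp _ _ (cesaro phi x N) [set y | y < a]).
  by move=> w _; exact: cces.
exact: open_lt.
Qed.

End unique_ergodicity.

(** * From invariant means to weak convergence *)

Section convergence.
Context {R : realType} {Omega : pmetricType R}.
Hypothesis cO : compact [set: Omega].

(** All limits of [E n] along free ultrafilters are invariant means on the orbit closure, so they
    agree at [x]. If [E n x] were infinitely often [e] away from the common value, an ultrafilter on
    those indices would give another value. *)
Lemma orbit_means_converge (phi : Omega -> Omega) (w : Omega)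
    (E : nat -> (Omega -> R) -> R) (x : Omega -> R) :
  continuous phi -> orbit_no_independent (R := R) phi ->
  (forall w : Omega,
    exists! m : set Omega, minimal_set phi m /\ m `<=` orbit_closure phi w) ->
  (forall n, mean (E n)) ->
  (forall n f, (forall z, orbit_closure phi w z -> f z = 0) -> E n f = 0) ->
  (forall f : Omega -> R, continuous f ->
    E n f - E n (fun z => f (phi z)) @[n --> \oo] --> 0) ->
  continuous x -> cvg (E n x @[n --> \oo]).
Proof.
move=> cphi NI uni mE supp erg cx.
have [m [[mm mw] _]] := uni w.
have mz z : orbit_closure phi w z -> m `<=` orbit_closure phi z.
  exact: unique_minimal_sub.
have inv U L : UltraFilter U -> (forall N, \forall n \near U, (N <= n)%N) -> mean L ->
    (forall f : Omega -> R, continuous f -> E n f @[n --> U] --> L f) ->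
    invariant_mean phi (orbit_closure phi w) L.
  move=> UU Utail mL EL; have UP : ProperFilter U by exact: ultra_proper.
  have Uoo : U --> \oo.
    by move=> A [N _ NA]; apply: filterS (Utail N); exact: NA.
  split=> // [f cf|f cf f0].
    have cf' : continuous (fun z => f (phi z)) := comp_iter_continuous cphi (n := 1) cf.
    apply/esym/eqP; rewrite -subr_eq0; apply/eqP.
    have c0 : E n f - E n (fun z => f (phi z)) @[n --> U] --> 0.
      exact: cvg_trans (cvg_app _ Uoo) (erg f cf).
    have c1 : E n f - E n (fun z => f (phi z)) @[n --> U] -->
        L f - L (fun z => f (phi z)).
      by apply: cvgB; exact: EL.
    exact: (norm_cvg_unique c1 c0).
  have /cvg_lim <- // := EL f cf.
  apply: cvg_lim => //; rewrite (_ : (fun n => E n f) = fun=> 0); first exact: cvg_cst.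
  by apply/funext => n; exact: supp.
have [U0 [UU0 Utail0 _]] := free_ultrafilter (F := \oo) _ (fun N => nbhs_infty_ge N).
have [L0 [mL0 EL0]] := mean_ultralimit cO UU0 mE.
apply/cvg_ex; exists (L0 x); apply/cvgrPdist_lt => e e0; apply: contrapT => far.
pose B N := [set n | (N <= n)%N /\ e <= `|L0 x - E n x| ].
have PF : ProperFilter (filter_from setT B).
  apply: filter_from_proper; last first.
    move=> N _; apply: contrapT => BN; apply: far; exists N => // n /= Nn.
    by rewrite ltNge; apply/negP => en; apply: BN; exists n.
  apply: filter_from_filter; first by exists 0%N.
  move=> i j _ _; exists (maxn i j) => // n [+ en].
  by rewrite geq_max => /andP[].
have tail N : \forall n \near filter_from setT B, (N <= n)%N.
  by exists N => // n [].
have [U1 [UU1 Utail1 FU1]] := free_ultrafilter PF tail.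
have UP1 : ProperFilter U1 by exact: ultra_proper.
have [L1 [mL1 EL1]] := mean_ultralimit cO UU1 mE.
have L01 : L0 x = L1 x.
  have cS : closed (orbit_closure phi w) by exact: closed_closure.
  have pS z : orbit_closure phi w z -> orbit_closure phi w (phi z).
    exact: orbit_closure_invariant.
  have uniq := invariant_mean_unique cO cphi NI cS pS mm mz.
  apply: uniq => //; [exact: inv UU0 Utail0 mL0 EL0|exact: inv UU1 Utail1 mL1 EL1].
have := EL1 x cx => /cvgrPdist_lt/(_ e e0) near1.
have [n [/= h1 [_ h2]]] : exists n, `|L1 x - E n x| < e /\ B 0%N n.
  have UB : U1 (B 0%N) by apply: FU1; exists 0%N.
  by have [n [h1 h2]] := filter_ex (filterI near1 UB); exists n.
by move: h2; rewrite L01 leNgt h1.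
Qed.

(** The open sets [F N], where the sequence still varies by more than [r] from index [N] on,
    decrease to the empty set. Their measure tends to 0, which makes the values of [l] a Cauchy
    sequence. *)
Lemma functional_cvg (l : (Omega -> R) -> R) M (g : nat -> Omega -> R) c :
  bounded_functional l M -> (forall n, continuous (g n)) ->
  (forall n w, `|g n w| <= c) -> (forall w, cvg (g n w @[n --> \oo])) ->
  cvg (l (g n) @[n --> \oo]).
Proof.
move=> lP cg gc gw.
have [mu [mufin _ mudom]] := dominating_measure cO lP.
have [lD lZ lM] := lP.
have lB (f h : Omega -> R) : continuous f -> continuous h ->
    l (fun w => f w - h w) = l f - l h.
  move=> cf ch; rewrite -mulN1r -lZ// -lD//; last first.
    by move=> w; apply: cvgMr; exact: ch.
  by congr l; apply/funext => w; rewrite mulN1r.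
have c0 : 0 <= c by exact: le_trans (gc 0%N point).
have M0 : 0 <= M.
  have c1 : continuous (fun _ : Omega => 1 : R) by move=> w; exact: cvg_cst.
  have := lM _ 1 c1; rewrite mulr1 => h; apply: (le_trans (normr_ge0 _) (h _)) => w.
  by rewrite normr1.
have osc n k r : open [set w | r < `|g n w - g k w| ].
  apply: (@open_comp _ _ (fun w => `|g n w - g k w|) [set y | r < y]).
    by move=> w _; apply: cvg_norm; apply: cvgB; exact: cg.
  exact: open_gt.
apply/cauchy_cvgP/cauchy_ballP => e e0.
(* [M] and [2 * c] come from the two terms of the domination estimate; the 1 makes the bound
   strict. *)
pose r := e / (1 + M + 2 * c); have r0 : 0 < r by rewrite divr_gt0//; lra.
have re : M * r + 2 * c * r < e.
  have -> : e = r + (M * r + 2 * c * r) by rewrite /r; field; apply/eqP; lra.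
  by rewrite ltrDr.
pose F N := [set w | exists n k, [/\ (N <= n)%N, (N <= k)%N & r < `|g n w - g k w|]].
have oF N : open (F N).
  rewrite (_ : F N = \bigcup_(p in [set p : nat * nat | (N <= p.1)%N /\ (N <= p.2)%N])
      [set w | r < `|g p.1 w - g p.2 w| ]).
    by apply: bigcup_open => p _; exact: osc.
  apply/seteqP; split=> w; first by move=> [n [k [Nn Nk h]]]; exists (n, k).
  by move=> [[n k] [Nn Nk] h]; exists n, k.
have mF N : measurable (F N : set (borel Omega)) by exact: sub_sigma_algebra.
have [||N NP] := rmeas_decreasing mufin r0 mF.
- by move=> n w [i [k [ni nk h]]]; exists i, k; split=> //; exact: ltnW.
- rewrite (_ : \bigcap_n F n = set0) ?measure0//; apply/seteqP; split=> // w Fw.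
  have /cvgrPdist_lt/(_ (r / 2)) := gw w.
  have r20 : 0 < r / 2 by lra.
  move=> /(_ r20)[N _ NP]; have [n [k [Nn Nk]]] := Fw N I.
  have := NP n Nn; have := NP k Nk; move: (lim _) => y /=.
  by have := ler_distD y (g n w) (g k w); rewrite (distrC (g n w) y); lra.
pose A := l @` [set g n | n in [set n | (N <= n)%N]].
exists (A, A); first by split; exists N => // n /= Nn; exists (g n) => //; exists n.
move=> [_ _] [/= [_ [n Nn <-] <-] [_ [k Nk <-] <-]]; rewrite /ball /=.
have cd : continuous (fun w => g n w - g k w).
  by move=> w; apply: cvgB; exact: cg.
rewrite -lB//; apply: le_lt_trans re.
apply: (le_trans (mudom _ (2 * c) r cd _ (ltW r0))).
  by move=> w; rewrite (le_trans (ler_normB _ _))//; have := gc n w; have := gc k w; lra.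
rewrite lerD2l ler_wpM2l//; first lra.
apply: le_trans (ltW (NP N (leqnn _))); apply: (le_rmeas mufin) => //.
  by apply: sub_sigma_algebra; exact: osc.
by move=> w h; exists n, k.
Qed.

End convergence.

(** * Ergodic operator sequences *)

(* Covers K = R (with [im = 0]) and K = R[i] at once. *)
Record coordinates (R : realType) (K : numFieldType) := Coordinates {
  io : R -> K ; re : K -> R ; im : K -> R ; ii : K ;
  ioD : {morph io : a b / a + b} ;
  ioM : {morph io : a b / a * b} ;
  ioN : {morph io : a / - a} ;
  io1 : io 1 = 1 ;
  io_le : forall a b, (io a <= io b) = (a <= b) ;
  io_norm : forall a, `|io a| = io `|a| ;
  reD : {morph re : z z' / z + z'} ;
  imD : {morph im : z z' / z + z'} ;
  reZ : forall a z, re (io a * z) = a * re z ;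
  imZ : forall a z, im (io a * z) = a * im z ;
  re_norm : forall z, io `|re z| <= `|z| ;
  im_norm : forall z, io `|im z| <= `|z| ;
  coordsE : forall z, z = io (re z) + ii * io (im z) ;
  real_coords : forall z, z \is Num.real -> z = io (re z)
}.

(** An existential over [True], because [real_or_complex] is a proposition with two constructors and
    cannot be eliminated into data. *)
Lemma real_or_complex_coordinates (R : realType) (K : numFieldType) :
  real_or_complex R K -> exists c : coordinates R K, True.
Proof.
case.
  unshelve eexists (@Coordinates R R id id (fun=> 0) 0
    _ _ _ _ _ _ _ _ _ _ _ _ _ _) => //.
  - by move=> z z'; rewrite addr0.
  - by move=> a z; rewrite mulr0.
  - by move=> z; rewrite normr0.
  - by move=> z; rewrite mul0r addr0.
have sqrt_le (a b : R) : `|a| <= Num.sqrt (a ^+ 2 + b ^+ 2).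
  by rewrite -sqrtr_sqr ler_wsqrtr// lerDl sqr_ge0.
pose io' (a : R) : complex R := Complex a 0.
have leE (a b : R) : (io' a <= io' b) = (a <= b) by rewrite lecE /= eqxx.
unshelve eexists (@Coordinates R (complex R) io' (@complex.Re R) (@complex.Im R)
  (Complex 0 1) _ _ _ erefl leE _ _ _ _ _ _ _ _ _) => //.
- by move=> a b; apply/eqP; rewrite eq_complex /= addr0 !eqxx.
- by move=> a b; apply/eqP; rewrite eq_complex /= !mulr0 !mul0r subr0 addr0 !eqxx.
- by move=> a; apply/eqP; rewrite eq_complex /= oppr0 !eqxx.
- by move=> a; rewrite normc_def /= expr0n addr0 sqrtr_sqr.
- by move=> [a b] [a' b'].
- by move=> [a b] [a' b'].
- by move=> a [b b'] /=; rewrite mul0r subr0.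
- by move=> a [b b'] /=; rewrite mul0r addr0.
- by move=> [a b]; rewrite normc_def leE /=; exact: sqrt_le.
- by move=> [a b]; rewrite normc_def leE /= addrC; exact: sqrt_le.
- move=> [a b]; apply/eqP; rewrite eq_complex /=.
  by rewrite !mul0r !mulr0 !mul1r subr0 !add0r !addr0 !eqxx.
- move=> [a b]; rewrite realE !lecE /= => h; apply/eqP; rewrite eq_complex /= eqxx /=.
  by case/orP: h => /andP[/eqP ->].
Qed.

Section coordinates_theory.
Context {R : realType} {K : numFieldType} (C : coordinates R K).
Local Notation io := (io C).
Local Notation re := (re C).
Local Notation im := (im C).

Lemma io0 : io 0 = 0.
Proof. by apply: (addrI (io 0)); rewrite -ioD !addr0. Qed.

Lemma io_sum (I : Type) (s : seq I) (F : I -> R) :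
  io (\sum_(i <- s) F i) = \sum_(i <- s) io (F i).
Proof. exact: (big_morph io (@ioD _ _ C) io0). Qed.

Lemma io_inj : injective io.
Proof.
by move=> a b ab; apply/eqP; rewrite eq_le -!(io_le C) ab lexx.
Qed.

Lemma ge0_coords z : 0 <= z -> z = io (re z) /\ 0 <= re z.
Proof.
move=> z0; have zE : z = io (re z) by apply: real_coords; exact: ger0_real.
by split=> //; rewrite -(io_le C) io0 -zE.
Qed.

Lemma gt0_coords z : 0 < z -> z = io (re z) /\ 0 < re z.
Proof.
move=> z0; have [zE re0] := ge0_coords (ltW z0); split=> //.
rewrite lt_neqAle re0 andbT; apply/eqP => h; move: z0.
by rewrite zE -h io0 ltxx.
Qed.

Lemma io_lt a b : (io a < io b) = (a < b).
Proof. by rewrite !lt_neqAle io_le (inj_eq io_inj). Qed.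

Lemma re_io a : re (io a) = a.
Proof.
apply: io_inj; rewrite -real_coords//.
have [a0|a0] := leP 0 a; first by rewrite ger0_real// -io0 io_le.
by rewrite ler0_real// -io0 io_le ltW.
Qed.

Lemma reN z : re (- z) = - re z.
Proof.
apply/eqP; rewrite -addr_eq0 -reD addNr.
by rewrite -io0 re_io.
Qed.

Lemma im0 : im 0 = 0.
Proof. by apply: (addrI (im 0)); rewrite -imD !addr0. Qed.

Lemma imN z : im (- z) = - im z.
Proof. by apply/eqP; rewrite -addr_eq0 -imD addNr im0. Qed.

Lemma io_cvg (u : nat -> R) : cvg (u n @[n --> \oo]) ->
  exists l : K, io (u n) @[n --> \oo] --> l.
Proof.
move=> /cvg_ex[l ul]; exists (io l).
apply/cvgrPdist_lt => e /gt0_coords[eE e0]; rewrite eE.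
move/cvgrPdist_lt : ul => /(_ _ e0); apply: filterS => n.
by rewrite -ioN -ioD io_norm io_lt.
Qed.

Lemma io_cvg0 (u : nat -> R) : io (u n) @[n --> \oo] --> 0 -> u n @[n --> \oo] --> 0.
Proof.
move=> ul; apply/cvgrPdist_lt => e e0.
have e0' : 0 < io e by rewrite -io0 io_lt.
move/cvgrPdist_lt : ul => /(_ _ e0'); apply: filterS => n.
by rewrite !sub0r !normrN io_norm io_lt.
Qed.

Lemma io_continuous (T : topologicalType) (f : T -> R) :
  continuous f -> continuous (fun w => io (f w)).
Proof.
move=> cf w; apply/cvgrPdist_lt => e /gt0_coords[eE e0]; rewrite eE.
move/cvgrPdist_lt : (cf w) => /(_ _ e0); apply: filterS => v.
by rewrite -ioN -ioD io_norm io_lt.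
Qed.

Lemma coords_continuous (T : topologicalType) (f : T -> K) : continuous f ->
  continuous (fun w => re (f w)) /\ continuous (fun w => im (f w)).
Proof.
move=> cf; split=> w; apply/cvgrPdist_lt => e e0;
  have e0' : 0 < io e by [rewrite -io0 io_lt];
  move/cvgrPdist_lt : (cf w) => /(_ _ e0'); apply: filterS => v fv;
  rewrite -io_lt (le_lt_trans _ fv)//.
  by rewrite -reN -reD re_norm.
by rewrite -imN -imD im_norm.
Qed.

Lemma norm_cvg_le (u : nat -> K) (l B : K) : u n @[n --> \oo] --> l ->
  (forall n, `|u n| <= B) -> `|l| <= B.
Proof.
move=> ul uB; have B0 : 0 <= B by exact: le_trans (uB 0%N).
have [BE _] := ge0_coords B0; have [lE _] := ge0_coords (normr_ge0 l).
rewrite BE lE io_le; apply/ler_addgt0Pr => e e0.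
have e0' : 0 < io e by rewrite -io0 io_lt.
have /filter_ex[n un] : \forall n \near \oo, `|l - u n| < io e.
  by move/cvgrPdist_lt : ul; apply.
rewrite -(io_le C) ioD -BE -lE (le_trans (_ : _ <= `|u n| + `|l - u n|))//.
  by rewrite -{1}(subrK (u n) l) addrC ler_normD.
by rewrite lerD// ltW.
Qed.

End coordinates_theory.

Arguments io0 {R K} C.
Arguments io_inj {R K} C.
Arguments ge0_coords {R K} C {z}.
Arguments io_continuous {R K} C {T f}.

Lemma bop_sumE (R : realType) (K : numFieldType) (hK : real_or_complex R K)
    (E F : normedModType K) (I : Type) (s : seq I) (f : I -> bop E F hK) u :
  (\sum_(i <- s) f i) u = \sum_(i <- s) f i u.
Proof. exact: (big_morph (fun g : bop E F hK => g u) (fun _ _ => erefl) erefl). Qed.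

Lemma bop_scaleE (R : realType) (K : numFieldType) (hK : real_or_complex R K)
    (E F : normedModType K) a (f : bop E F hK) u : (a *: f) u = a *: f u.
Proof. by []. Qed.

Section koopman_operators.
Context {R : realType} {K : numFieldType} (hK : real_or_complex R K).
Context {Omega : pmetricType R} (cO : compact [set: Omega]).
Context (phi : Omega -> Omega) (cphi : continuous phi).
Variable C : coordinates R K.
Local Notation X := (cfun hK cO).
Local Notation io := (io C).
Local Notation re := (re C).
Local Notation im := (im C).
Local Notation U := (koopman hK cO cphi).
Local Notation EndX := (bop (dual hK X) (dual hK X) hK).

Lemma cfun_sumE (I : Type) (s : seq I) (F : I -> X) w :
  (\sum_(i <- s) F i) w = \sum_(i <- s) F i w.
Proof. exact: (big_morph (fun z : X => z w) (fun _ _ => erefl) erefl). Qed.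

(** By [independent_l1], independent translates would make [(b - a) / 2] a lower bound of the norms
    in [tame], whose infimum is 0. *)
Lemma tame_no_independent : tame hK cO cphi -> orbit_no_independent (R := R) phi.
Proof.
move=> tame_phi x cx a b ab [n [n0 nS ind]].
have cx' := io_continuous C cx.
have [_ /(_ (io ((b - a) / 2)))] := tame_phi (mkcfun hK cO cx') n n0 nS.
have : ~ io ((b - a) / 2) <= 0 by rewrite -(io0 C) io_le; apply/negP; rewrite -ltNge; lra.
move=> /[swap] h; apply; apply: h => _ [N [c [creal c1 ->]]].
set s := \sum_k _; have [sE _] := ge0_coords C (normr_ge0 s).
have cE k : c k = io (re (c k)) by exact: real_coords.
rewrite sE io_le; apply: (independent_l1 ab ind (a := fun k => re (c k))).
  apply: (io_inj C); rewrite io1 io_sum -c1; apply: eq_bigr => k _.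
  by rewrite -io_norm -cE.
move=> w; rewrite -(io_le C) -io_norm -sE io_sum.
have -> : \sum_k io (re (c k) * x (iter (n k) phi w)) = s w.
  rewrite /s cfun_sumE; apply: eq_bigr => k _.
  have E := iter_koopmanE cphi (n k) (mkcfun hK cO cx') w.
  by rewrite ioM -cE -[io _]E.
exact: cfun_norm_ub.
Qed.

Lemma bpow_adjointE k (y : dual hK X) (x : X) :
  bpow (adjoint U) k y x = y (iter k U x).
Proof.
elim: k x => // k IH x; rewrite -[LHS]/(bpow (adjoint U) k y (U x)) IH.
by rewrite -iterSr.
Qed.

(** Coefficients and exponents become functions on [nat], of a type independent of the number of
    terms, so that [choice] can select them for a whole sequence of operators. *)
Lemma G0P (T : EndX) : G0 cphi T -> exists d : nat * (nat -> R) * (nat -> nat),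
  [/\ forall i, 0 <= d.1.2 i, \sum_(i < d.1.1) d.1.2 i = 1 &
    forall y x, T y x = \sum_(i < d.1.1) io (d.1.2 i) * y (iter (d.2 i) U x)].
Proof.
move=> [N [a [u [a0 a1 Au ->]]]].
have [k kE] : exists k : 'I_N -> nat, forall i, u i = bpow (adjoint U) (k i).
  suff /choice[k kE] : forall i, exists k, u i = bpow (adjoint U) k by exists k.
  by move=> i; have [k _ <-] := Au i; exists k.
pose ext (A : Type) (z : A) (g : 'I_N -> A) j := if insub j is Some i then g i else z.
have extE (A : Type) (z : A) g (i : 'I_N) : ext A z g i = g i by rewrite /ext valK.
exists (N, ext R 0 (fun i => re (a i)), ext nat 0%N k); split=> /= [j||y x].
- by rewrite /ext; case: insubP => // i _ _; have [] := ge0_coords C (a0 i).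
- apply: (io_inj C); rewrite io1 io_sum -a1; apply: eq_bigr => i _.
  by rewrite extE; have [<-] := ge0_coords C (a0 i).
rewrite 2!bop_sumE; apply: eq_bigr => i _; rewrite !extE; have [<- _] := ge0_coords C (a0 i).
transitivity (a i * u i y x); last by rewrite kE bpow_adjointE.
apply: etrans (bop_scaleE (a i) (u i y : bop X K^o hK) x).
by rewrite (bop_scaleE (a i) (u i) y).
Qed.

Lemma eval_linear (w : Omega) : linear (fun x : X => x w : K^o).
Proof. by []. Qed.

Lemma eval_bounded (w : Omega) :
  exists M, forall x : X, `|(x w : K^o)| <= M * `|x|.
Proof. by exists 1 => x; rewrite mul1r; exact: cfun_norm_ub. Qed.

(** The Dirac measure at [w]. *)
Definition evaluation (w : Omega) : dual hK X :=
  mkbop hK (eval_linear w) (eval_bounded w).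

(* The restriction of [y] to real-valued functions, with a junk value off C(Omega). *)
Definition real_restriction (y : dual hK X) (f : Omega -> R) : K :=
  if pselect (continuous (fun w => io (f w))) is left cf
  then y (mkcfun hK cO cf) else 0.

Lemma real_restrictionE (y : dual hK X) (f : Omega -> R) (x : X) :
  continuous f -> (forall w, x w = io (f w)) -> real_restriction y f = y x.
Proof.
move=> cf xf; rewrite /real_restriction.
case: pselect => [cf'|[]]; last exact: io_continuous.
by congr (y _); apply/val_inj/funext => w /=; rewrite xf.
Qed.

Lemma real_restriction_bounded (y : dual hK X) :
  bounded_functional (fun f : Omega -> R => re (real_restriction y f))
    (re (bop_norm y)) /\
  bounded_functional (fun f : Omega -> R => im (real_restriction y f))
    (re (bop_norm y)).
Proof.
have mk (f : Omega -> R) : continuous f -> exists x : X, forall w, x w = io (f w).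
  by move=> cf; exists (mkcfun hK cO (io_continuous C cf)).
have yD (f g : Omega -> R) : continuous f -> continuous g ->
    real_restriction y (fun w => f w + g w) =
    real_restriction y f + real_restriction y g.
  move=> cf cg; have [xf fE] := mk f cf; have [xg gE] := mk g cg.
  rewrite (real_restrictionE y cf fE) (real_restrictionE y cg gE) -linearD.
  apply: real_restrictionE => w; first by apply: cvgD; [exact: cf|exact: cg].
  by rewrite ioD -fE -gE.
have yZ a (f : Omega -> R) : continuous f ->
    real_restriction y (fun w => a * f w) = io a * real_restriction y f.
  move=> cf; have [xf fE] := mk f cf.
  rewrite (real_restrictionE y cf fE) -[RHS]/(io a *: (y xf : K^o)) -linearZ.
  apply: real_restrictionE => w; first by apply: cvgMr; exact: cf.
  by rewrite ioM -fE.
have yM (f : Omega -> R) (c : R) : continuous f -> (forall w, `|f w| <= c) ->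
    `|real_restriction y f| <= io (re (bop_norm y) * c).
  move=> cf fc; have [xf fE] := mk f cf; rewrite (real_restrictionE y cf fE).
  rewrite (le_trans (bop_norm_ub y xf))// ioM.
  have [<- _] := ge0_coords C (bop_norm_ge0 y).
  rewrite ler_wpM2l ?bop_norm_ge0//; apply: cfun_norm_le => [|w].
    by rewrite -(io0 C) io_le (le_trans (normr_ge0 _) (fc point)).
  by rewrite fE io_norm io_le.
split; split=> [f g cf cg|a f cf|f c cf fc].
- by rewrite yD// reD.
- by rewrite yZ// reZ.
- by rewrite -(io_le C) (le_trans (re_norm C _))// yM.
- by rewrite yD// imD.
- by rewrite yZ// imZ.
- by rewrite -(io_le C) (le_trans (im_norm C _))// yM.
Qed.

Lemma real_restriction_sum (y : dual hK X) (I : Type) (s : seq I) (a : I -> R)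
    (F : I -> Omega -> R) : (forall i, continuous (F i)) ->
  real_restriction y (fun w => \sum_(i <- s) a i * F i w) =
  \sum_(i <- s) io (a i) * real_restriction y (F i).
Proof.
move=> cF; have caF i : continuous (fun w => a i * F i w).
  by move=> w; apply: cvgMr; exact: cF.
pose x i := mkcfun hK cO (io_continuous C (cF i)).
rewrite (@real_restrictionE y _ (\sum_(i <- s) io (a i) *: x i)); first last.
- by move=> w; rewrite cfun_sumE io_sum; apply: eq_bigr => i _; rewrite ioM.
- exact: continuous_bigsum.
rewrite linear_sum; apply: eq_bigr => i _.
by rewrite linearZ (@real_restrictionE y _ (x i)).
Qed.

End koopman_operators.

(** The bound passes to the limits: each is a bounded functional of [x], and the limit operator is
    bounded with constant 1. *)
Lemma wstar_limit (R : realType) (K : numFieldType) (hK : real_or_complex R K)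
    (C : coordinates R K) (E : normedModType K)
    (T_ : nat -> bop (dual hK E) (dual hK E) hK) :
  (forall n y x, `|T_ n y x| <= bop_norm y * `|x|) ->
  (forall y x, exists l : K, (T_ n y x : K) @[n --> \oo] --> l) ->
  exists T, wstar_cvg T_ T.
Proof.
move=> Tle Tcvg.
have [L LP] : exists L : dual hK E -> E -> K,
    forall y x, (T_ n y x : K) @[n --> \oo] --> L y x.
  have /choice[L LP] : forall p : dual hK E * E, exists l : K,
    (T_ n p.1 p.2 : K) @[n --> \oo] --> l by move=> [y x]; exact: Tcvg.
  by exists (fun y x => L (y, x)) => y x; exact: (LP (y, x)).
have Lle y x : `|L y x| <= bop_norm y * `|x|.
  by apply: (norm_cvg_le C (LP y x)) => n; exact: Tle.
have Llin y : linear (L y : E -> K^o).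
  move=> a u v; apply: (norm_cvg_unique (LP y (a *: u + v))).
  rewrite (_ : (fun n => _) = fun n => a * (T_ n y u : K) + (T_ n y v : K)).
    by apply: cvgD; [apply: cvgMr; exact: LP|exact: LP].
  by apply/funext => n; rewrite linearP.
pose Ty y : dual hK E := mkbop hK (Llin y) (ex_intro _ (bop_norm y) (Lle y)).
have Tlin : linear Ty.
  move=> a y z; apply/val_inj/funext => x.
  apply: (norm_cvg_unique (LP (a *: y + z) x)).
  rewrite (_ : (fun n => _) = fun n => a * (T_ n y x : K) + (T_ n z x : K)).
    by apply: cvgD; [apply: cvgMr; exact: LP|exact: LP].
  by apply/funext => n; rewrite linearP.
have Tbnd : exists M, forall y, `|Ty y| <= M * `|y|.
  exists 1 => y; rewrite mul1r; apply: bop_norm_le; first exact: bop_norm_ge0.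
  exact: Lle.
exists (mkbop hK Tlin Tbnd); apply/wstar_cvgP => x y; exact: LP.
Qed.

(** For real [x], let [E w n x] be the value at [x] of [T_ n] applied to the Dirac measure at [w].
    Then [T_ n y x] is [y] applied to the function of [w] so obtained. These functions are uniformly
    bounded and converge pointwise, so [functional_cvg] applies to the real and imaginary parts of
    [y]. *)
Lemma ergodic_sequence_cvg (R : realType) (K : numFieldType)
    (hK : real_or_complex R K)
    (Omega : pmetricType R) (cO : compact [set: Omega])
    (phi : Omega -> Omega) (cphi : continuous phi)
    (T_ : nat -> bop (dual hK (cfun hK cO)) (dual hK (cfun hK cO)) hK) :
  tame hK cO cphi ->
  (forall w : Omega,
    exists! m : set Omega, minimal_set phi m /\ m `<=` orbit_closure phi w) ->
  ergodic_sequence cphi T_ -> exists T, wstar_cvg T_ T.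
Proof.
move=> tame_phi uni [TG0 Terg].
have [C _] := real_or_complex_coordinates hK.
have NI := tame_no_independent C tame_phi.
have [d dP] := choice (fun n => G0P C (TG0 n)).
pose E w n (f : Omega -> R) :=
  \sum_(i < (d n).1.1) (d n).1.2 i * f (iter ((d n).2 i) phi w).
have mE w n : mean (E w n).
  have [d0 d1 _] := dP n.
  by apply: (@weighted_mean _ _ _ (fun i : 'I_(d n).1.1 => (d n).1.2 i)).
have Ecvg w f : continuous f -> cvg (E w n f @[n --> \oo]).
  apply: (@orbit_means_converge _ _ cO phi w) => // [n g g0|g cg].
    by rewrite /E big1// => i _; rewrite g0 ?mulr0//; exact: orbit_closure_iter.
  apply: (io_cvg0 (C := C)).
  pose x := mkcfun hK cO (io_continuous C cg).
  (* Tested on a Dirac measure, ergodicity of [T_] is the asymptotic invariance of the means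
     [E w n]. *)
  have := (wstar_cvgP _ _).1 Terg x (evaluation hK cO w).
  rewrite (_ : (fun n => _) = (fun n => io C (E w n g - E w n (fun z => g (phi z)))))//.
  apply/funext => n; have [_ _ TE] := dP n.
  set U := koopman hK cO cphi in TE *; set dw := evaluation hK cO w.
  rewrite -[LHS]/(T_ n (dw - adjoint U dw) x).
  rewrite TE /E -sumrB io_sum; apply: eq_bigr => i _.
  rewrite -mulrBr ioM; congr (_ * _); rewrite ioD ioN.
  set k := (d n).2 i.
  have E1 := iter_koopmanE cphi k x w; have E2 := iter_koopmanE cphi k.+1 x w.
  rewrite -[io C (g _)]E1.
  by rewrite -[io C (g (phi _))]E2 iterS.
have gcvg (y : dual hK (cfun hK cO)) (f : Omega -> R) : continuous f -> exists l : K,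
    real_restriction C y (fun w => E w n f) @[n --> \oo] --> l.
  move=> cf; have [c c0 fc] := continuous_bounded cO cf.
  have cE n : continuous (fun w => E w n f).
    apply: (continuous_bigsum (F := fun (i : 'I_(d n).1.1) w =>
      (d n).1.2 i * f (iter ((d n).2 i) phi w))) => i w.
    by apply: cvgMr; exact: comp_iter_continuous.
  have cb n w : `|E w n f| <= c by exact: mean_norm_le.
  have [reb imb] := real_restriction_bounded C y.
  have [l1 l1P] := io_cvg C
    (functional_cvg cO reb cE cb (fun w => Ecvg w f cf)).
  have [l2 l2P] := io_cvg C
    (functional_cvg cO imb cE cb (fun w => Ecvg w f cf)).
  exists (l1 + ii C * l2).
  pose z n := real_restriction C y (fun w => E w n f).
  rewrite (_ : (fun n => _) = (fun n => io C (re C (z n)) + ii C * io C (im C (z n))));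
    last first.
    by apply/funext => n; rewrite -coordsE.
  by apply: cvgD => //; apply: cvgMr.
apply: (wstar_limit C) => [n y x|y x].
  have [d0 d1 ->] := dP n.
  rewrite (le_trans (ler_norm_sum _ _ _))//.
  have -> : bop_norm y * `|x| =
      \sum_(i < (d n).1.1) io C ((d n).1.2 i) * (bop_norm y * `|x|).
    by rewrite -mulr_suml -io_sum d1 io1 mul1r.
  apply: ler_sum => i _; rewrite normrM io_norm (ger0_norm (d0 i)); apply: ler_wpM2l.
    by rewrite -(io0 C) io_le.
  apply: (le_trans (bop_norm_ub y _)); apply: ler_wpM2l; first exact: bop_norm_ge0.
  apply: cfun_norm_le; first exact: cfun_norm_ge0.
  by move=> w; rewrite iter_koopmanE; exact: cfun_norm_ub.
(* Means act on real functions, so the two coordinates of [x] are treated apart and recombined by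
   [coordsE]. *)
have [cre cim] := coords_continuous C (@cfun_continuous _ _ _ _ _ x).
have [l1 l1P] := gcvg y _ cre; have [l2 l2P] := gcvg y _ cim.
exists (l1 + ii C * l2).
rewrite (_ : (fun n => _) = (fun n =>
    real_restriction C y (fun w => E w n (fun v => re C (x v))) +
    ii C * real_restriction C y (fun w => E w n (fun v => im C (x v))))).
  by apply: cvgD => //; apply: cvgMr.
apply/funext => n; have [_ _ ->] := dP n.
have crek k := comp_iter_continuous cphi (n := k) cre.
have cimk k := comp_iter_continuous cphi (n := k) cim.
rewrite /E.
rewrite (real_restriction_sum C y _ _
  (F := fun (i : 'I_(d n).1.1) w => re C (x (iter ((d n).2 i) phi w))))//.
rewrite (real_restriction_sum C y _ _
  (F := fun (i : 'I_(d n).1.1) w => im C (x (iter ((d n).2 i) phi w))))//.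
rewrite mulr_sumr -big_split /=; apply: eq_bigr => i _.
rewrite mulrCA -mulrDr; congr (_ * _); set k := (d n).2 i.
pose x1 := mkcfun hK cO (io_continuous C (crek k)).
pose x2 := mkcfun hK cO (io_continuous C (cimk k)).
rewrite (@real_restrictionE _ _ _ _ _ C y _ x1)//.
rewrite (@real_restrictionE _ _ _ _ _ C y _ x2)//.
rewrite -[ii C * y x2]/(ii C *: (y x2 : K^o)) -linearZ -linearD; congr (y _).
by apply/val_inj/funext => w /=; rewrite iter_koopmanE [LHS](coordsE C).
Qed.

Theorem theorem3p6 (R : realType) (K : numFieldType)
    (hK : real_or_complex R K)
    (Omega : pmetricType R) (cO : compact [set: Omega])
    (phi : Omega -> Omega) (cphi : continuous phi)
    (tame_phi : tame hK cO cphi)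
    (unique_minimal : forall w : Omega,
      exists! m : set Omega, minimal_set phi m /\ m `<=` orbit_closure phi w) :
  (forall T_ : nat -> bop (dual hK (cfun hK cO)) (dual hK (cfun hK cO)) hK,
     ergodic_sequence cphi T_ -> exists T, wstar_cvg T_ T) /\
  (forall la : probability (borel Omega) R,
     ergodic_measure phi la -> minimal_set phi (measure_support la)).
Proof.
split=> [T_|la erg]; first exact: ergodic_sequence_cvg.
have [C _] := real_or_complex_coordinates hK.
exact: (ergodic_support_minimal cO cphi (tame_no_independent C tame_phi)).
Qed.
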